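(* Graph Isomorphism is GI-complete on $(\mathrm{diamond},2P_3)$-free graphs.
   Context: Graph Isomorphism is the problem of deciding, given two graphs $G$ and $H$, whether there is an isomorphism from $G$ to $H$; a problem is GI-complete if it is polynomial-time equivalent to Graph Isomorphism. A graph is $(H_1,H_2)$-free if it contains no induced subgraph isomorphic to $H_1$ or $H_2$. The diamond is $\overline{2P_1+P_2}$ (i.e. $K_4$ minus an edge); $P_r$ denotes the path on $r$ vertices and $tG$ denotes $t$ disjoint copies of $G$. *)

(* Defs.v *)
From mathcomp Require Import all_boot.
Set Implicit Arguments. Unset Strict Implicit. Unset Printing Implicit Defensive.

(* Finite simple graphs on vertex set {0,..,n-1}, given by a row-major *)
(* adjacency matrix (a bit string of length n*n).                       *)
Record graph := Graph { gn : nat; gadj : seq bool }.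

Definition gedge (G : graph) (i j : nat) : bool := nth false (gadj G) (i * gn G + j).

Definition simple_graph (G : graph) : Prop :=
  size (gadj G) = gn G * gn G /\
  forall i j, i < gn G -> j < gn G -> gedge G i j = gedge G j i /\ ~~ gedge G i i.

Definition isomorphic (G H : graph) : Prop :=
  exists f : 'I_(gn G) -> 'I_(gn H),
    bijective f /\ forall i j : 'I_(gn G), gedge G i j = gedge H (f i) (f j).

Definition induced_sub (P G : graph) : Prop :=
  exists f : 'I_(gn P) -> 'I_(gn G),
    injective f /\ forall i j : 'I_(gn P), gedge P i j = gedge G (f i) (f j).

(* diamond = K4 minus the edge {2,3} (the complement of 2P1+P2) *)
Definition diamond : graph := Graph 4
  [:: false; true; true; true;
      true; false; true; true;
      true; true; false; false;
      true; true; false; false].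

(* 2P3 = two disjoint paths 0-1-2 and 3-4-5 *)
Definition twoP3 : graph := Graph 6
  [:: false; true; false; false; false; false;
      true; false; true; false; false; false;
      false; true; false; false; false; false;
      false; false; false; false; true; false;
      false; false; false; true; false; true;
      false; false; false; false; true; false].

Definition diamond_2P3_free (G : graph) : Prop :=
  ~ induced_sub diamond G /\ ~ induced_sub twoP3 G.

Definition enc_nat (n : nat) : seq bool := nseq n true ++ [:: false].
Definition enc_graph (G : graph) : seq bool := enc_nat (gn G) ++ gadj G.
Definition enc_pair (G H : graph) : seq bool := enc_graph G ++ enc_graph H.

(* Deterministic single-tape Turing machines (finite state set and     *)
(* finite tape alphabet).  Symbol 0 = blank, 1 = bit false, 2 = bit     *)
(* true, other symbols auxiliary.  State 0 is the start state; the      *)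
(* machine halts when the transition table gives None.  Move: true =    *)
(* right, false = left.                                                 *)
Record TM := MkTM {
  tm_q : nat; tm_s : nat;
  tm_delta : 'I_tm_q.+1 -> 'I_tm_s.+3 -> option ('I_tm_q.+1 * 'I_tm_s.+3 * bool) }.

Record config (M : TM) := Config {
  c_state : 'I_(tm_q M).+1;
  c_left : seq 'I_(tm_s M).+3;   (* reversed: nearest cell first *)
  c_head : 'I_(tm_s M).+3;
  c_right : seq 'I_(tm_s M).+3 }.

Definition blank {n} : 'I_n.+3 := ord0.
Definition sym_of_bool {n} (b : bool) : 'I_n.+3 := if b then inord 2 else inord 1.
Definition bool_of_sym {n} (a : 'I_n.+3) : option bool :=
  if val a == 1 then Some false else if val a == 2 then Some true else None.

Definition step (M : TM) (c : config M) : config M :=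
  match tm_delta (c_state c) (c_head c) with
  | None => c
  | Some (q', a, mvR) =>
      if mvR then
        match c_right c with
        | [::] => Config q' (a :: c_left c) blank [::]
        | b :: r => Config q' (a :: c_left c) b r
        end
      else
        match c_left c with
        | [::] => Config q' [::] blank (a :: c_right c)
        | b :: l => Config q' l b (a :: c_right c)
        end
  end.

Definition halted (M : TM) (c : config M) : bool :=
  if tm_delta (c_state c) (c_head c) is None then true else false.

Fixpoint bits_prefix {n} (s : seq 'I_n.+3) : seq bool :=
  match s with
  | [::] => [::]
  | a :: s' => if bool_of_sym a is Some b then b :: bits_prefix s' else [::]
  end.

Definition output (M : TM) (c : config M) : seq bool := bits_prefix (c_head c :: c_right c).

Definition init (M : TM) (x : seq bool) : config M :=
  match map sym_of_bool x with
  | [::] => Config ord0 [::] blank [::]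
  | a :: r => Config ord0 [::] a r
  end.

Definition poly_computable (f : seq bool -> seq bool) : Prop :=
  exists (M : TM) (c : nat), forall x : seq bool,
    let cf := iter (c * (size x).+1 ^ c) (@step M) (init M x) in
    halted cf /\ output cf = f x.

Definition poly_reduces (L1 L2 : seq bool -> Prop) : Prop :=
  exists f, poly_computable f /\ forall x, L1 x <-> L2 (f x).

Definition GI_on (C : graph -> Prop) (x : seq bool) : Prop :=
  exists G H, [/\ simple_graph G, simple_graph H, C G & C H] /\
              x = enc_pair G H /\ isomorphic G H.

Definition GI : seq bool -> Prop := GI_on (fun _ => True).

Definition GI_complete (C : graph -> Prop) : Prop :=
  poly_reduces GI (GI_on C) /\ poly_reduces (GI_on C) GI.

(* Main.v *)
(** For the hardness half, replace every edge of a graph by a path of length three and make the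
    original vertices a clique.  The remaining vertices then induce a graph without P3, so every
    P3 meets the clique and two disjoint nonadjacent ones are impossible; a vertex outside the
    clique lies in no triangle, so there is no diamond either.  With at least three original
    vertices the clique is recognised by its degrees, and the graph can be read back.

    For the other half, a graph is tested for the two forbidden subgraphs by brute force over its
    4-tuples and 6-tuples, and an instance that fails the test is replaced by the empty string,
    which encodes no pair of graphs.

    Both maps are computed by loop programs over finitely many pointers into the input.  A Turing
    machine keeps the pointers as marks on the cells of the input and executes each elementary
    instruction by one sweep over the tape; loops run over the input positions, so a program with
    nesting depth d takes a number of instructions polynomial of degree d. *)

From HB Require Import structures.
Require Import Defs.
From mathcomp Require Import all_boot.
From mathcomp Require Import zify.
Set Implicit Arguments. Unset Strict Implicit. Unset Printing Implicit Defensive.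

(** Both reductions must be right on every bit string, not only on encodings of simple graphs, and
    neither of them tests simplicity. New vertices are attached to all ordered pairs (u, v) with u
    <> v, not only to edges; a nonedge just leaves two pendant vertices. So the new graph always has
    n * n vertices, no numbering of edges has to be computed, and each matrix entry depends on
    equalities of coordinates and on at most one input bit. The entry at (u, v), (v, u) is that
    input bit, also for u = v; hence asymmetry and loops survive, and the output is simple exactly
    when the input is. The other reduction searches only the first graph, since freeness passes to
    the second one along the isomorphism of a yes-instance. With two original vertices the degrees
    do not single out the clique; there the new graph is a 4-cycle or a path on four vertices,
    according to whether there is an edge. A pointer may run past the end of the input. The
    semantics keeps its exact number, while the machine only sees that its mark is missing; this is
    what ends a loop. *)

Definition poly_bounded (f : nat -> nat) :=
  exists c, forall n, f n <= c * n.+1 ^ c.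

Lemma poly_bounded_const k : poly_bounded (fun=> k).
Proof. by exists k => n; rewrite leq_pmulr // expn_gt0. Qed.

Lemma poly_bounded_id : poly_bounded id.
Proof. by exists 1 => n; rewrite mul1n expn1. Qed.

Lemma poly_bounded_add f g :
  poly_bounded f -> poly_bounded g -> poly_bounded (fun n => f n + g n).
Proof.
move=> [c Hc] [d Hd]; exists (c + d) => n; rewrite mulnDl leq_add //.
- by rewrite (leq_trans (Hc n)) // leq_mul2l leq_pexp2l ?leq_addr ?orbT.
- by rewrite (leq_trans (Hd n)) // leq_mul2l leq_pexp2l ?leq_addl ?orbT.
Qed.

Lemma poly_bounded_mul f g :
  poly_bounded f -> poly_bounded g -> poly_bounded (fun n => f n * g n).
Proof.
move=> [c Hc] [d Hd]; exists (c * d + (c + d)) => n.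
rewrite (leq_trans (leq_mul (Hc n) (Hd n))) // mulnACA -expnD.
by rewrite leq_mul ?leq_addr // leq_pexp2l ?leq_addl.
Qed.

(** * Turing machines over arbitrary finite alphabets *)

Section AbstractMachine.
Variables Q C : finType.

(* [None] is the blank; the initial state is [None : option Q]. *)
Definition asym := option (bool + C).

Variable delta : option Q -> asym -> option (option Q * asym * bool).

(* A configuration (q, l, r): the head scans the first symbol of [r]. *)
Definition aconf := (option Q * seq asym * seq asym)%type.

Definition astep (c : aconf) : aconf :=
  let: (q, l, r) := c in
  match delta q (head None r) with
  | None => c
  | Some (q', a, true) => (q', a :: l, behead r)
  | Some (q', a, false) => (q', behead l, head None l :: a :: behead r)
  end.

Definition sym_code (a : asym) : 'I_#|C|.+3 :=
  match a with
  | None => blank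
  | Some (inl b) => sym_of_bool b
  | Some (inr c) => inord (enum_rank c).+3
  end.

Definition sym_decode (a : 'I_#|C|.+3) : asym :=
  match nat_of_ord a with
  | 0 => None
  | 1 => Some (inl false)
  | 2 => Some (inl true)
  | k.+3 => omap (fun i => inr (enum_val i)) (insub k : option 'I_#|C|)
  end.

Lemma sym_codeK : cancel sym_code sym_decode.
Proof.
case=> [[b|c]|] //=; rewrite /sym_decode; first by case: b; rewrite inordK.
rewrite inordK ?ltnS ?ltn_ord //= (insubT (fun i => i < #|C|)) ?ltn_ord // => Hlt.
by rewrite /= -[Sub _ _]/(Ordinal _) (_ : Ordinal _ = enum_rank c) ?enum_rankK //; apply/val_inj.
Qed.

Definition estate (q : option Q) : 'I_#|Q|.+1 :=
  if q is Some q then lift ord0 (enum_rank q) else ord0.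

Definition dstate (s : 'I_#|Q|.+1) : option Q := omap enum_val (unlift ord0 s).

Lemma estateK : cancel estate dstate.
Proof. by case=> [q|]; rewrite /dstate /= ?liftK ?unlift_none //= enum_rankK. Qed.

Definition machine : TM := @MkTM #|Q| #|C| (fun s a =>
  omap (fun t : option Q * asym * bool => (estate t.1.1, sym_code t.1.2, t.2))
       (delta (dstate s) (sym_decode a))).

Definition econf (c : aconf) : config machine :=
  let: (q, l, r) := c in
  @Config machine (estate q) (map sym_code l) (sym_code (head None r)) (map sym_code (behead r)).

Lemma step_econf c : step (econf c) = econf (astep c).
Proof.
case: c => [[q l] r]; rewrite /step /= estateK sym_codeK.
case: (delta q _) => [[[q' a] []]|] //=.
- by case: r => [|b [|b' r]].
- by case: l => [|b l].
Qed.

Lemma iter_step_econf n c : iter n (@step machine) (econf c) = econf (iter n astep c).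
Proof. by elim: n => //= n ->; rewrite step_econf. Qed.

Definition abit (b : bool) : asym := Some (inl b).

Lemma init_econf x : init machine x = econf (None, [::], map abit x).
Proof. by case: x => [|b x] //=; rewrite /init /= -map_comp. Qed.

Lemma bits_prefix_sym_code (y : seq bool) m :
  bits_prefix (map sym_code (map abit y ++ nseq m None)) = y.
Proof.
elim: y => [|b y IH] /=; first by case: m.
by rewrite IH; case: b; rewrite /bool_of_sym /= inordK.
Qed.

(** [poly_computable] prescribes the exact number of steps, so a machine that halts earlier is
    simply run on: a halted configuration is a fixed point of [step]. Blanks after the output are
    harmless because [bits_prefix] stops at the first of them. *)
Lemma abstract_poly_computable (g : seq bool -> seq bool)
    (B : nat -> nat) : poly_bounded B ->
  (forall x, exists t q l m, [/\ t <= B (size x),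
     iter t astep (None, [::], map abit x) = (q, l, map abit (g x) ++ nseq m None)
     & forall a, delta q (head None (map abit (g x) ++ nseq m None)) <> Some a]) ->
  poly_computable g.
Proof.
move=> [c Hc] H; exists machine, c => x /=.
have [t [q [l [m [Ht Hrun Hstop]]]]] := H x.
have stop : delta q (head None (map abit (g x) ++ nseq m None)) = None.
  by case E: (delta _ _) => [a|] //; case: (Hstop a).
rewrite -(subnK (leq_trans Ht (Hc (size x)))) iterD init_econf !iter_step_econf Hrun.
set r := map abit (g x) ++ nseq m None in stop *.
have -> k : iter k astep (q, l, r) = (q, l, r).
  by elim: k => //= k ->; rewrite /astep /= stop.
split; first by rewrite /halted /= estateK sym_codeK stop.
rewrite /output /= -[RHS](bits_prefix_sym_code (g x) m) -/r.
by case: (r) => [|b [|b' r']].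
Qed.

End AbstractMachine.

(** * Pointer machines *)

Section PointerMachine.
Variable V : finType.

(* [Move i j b] sets pointer [i] to the position of [j], plus one if [b]. *)
Inductive act := Zero of V | Move of V & V & bool | Out of bool.

(* What one sweep over the input region records: which pointers have been met,
   which pairs (i, j) satisfy i <= j, and which pointers scan a bit [true]. *)
Definition obs := ({ffun V -> bool} * {ffun V * V -> bool} * {ffun V -> bool})%type.

Definition obs_seen (i : V) (o : obs) := o.1.1 i.
Definition obs_le (i j : V) (o : obs) := o.1.2 (i, j).
Definition obs_bit (i : V) (o : obs) := o.2 i.

(* [Branch b t] jumps to [t] when [b] is false. *)
Inductive instr := Do of act | Branch of (obs -> bool) & nat.

Definition env := {ffun V -> nat}.
Definition pstate := (env * seq bool)%type.

Definition upd (e : env) (i : V) (v : nat) : env :=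
  [ffun j => if j == i then v else e j].

Definition do_act (a : act) (s : pstate) : pstate :=
  match a with
  | Zero i => (upd s.1 i 0, s.2)
  | Move i j b => (upd s.1 i (s.1 j + b), s.2)
  | Out b => (s.1, rcons s.2 b)
  end.

Definition cellT := (option bool * {ffun V -> bool})%type.

Definition cell (x : seq bool) (e : env) (p : nat) : cellT :=
  (if p < size x then Some (nth false x p) else None, [ffun i => e i == p]).

Definition obs_at (x : seq bool) (e : env) (p : nat) : obs :=
  ([ffun i => e i < p],
   [ffun ij => (e ij.1 < p) && (e ij.1 <= e ij.2)],
   [ffun i => (e i < p) && nth false x (e i)]).

(** The region has [size x + 1] cells, the last being an end cell without a bit. A pointer beyond it
    has no mark: it is never seen and compares as larger than every pointer inside. *)
Definition observe x e := obs_at x e (size x).+1.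

Lemma obs_seenE x e i : obs_seen i (observe x e) = (e i <= size x).
Proof. by rewrite /obs_seen ffunE ltnS. Qed.

Lemma obs_leE x e i j :
  obs_le i j (observe x e) = (e i <= size x) && (e i <= e j).
Proof. by rewrite /obs_le ffunE ltnS. Qed.

Lemma obs_bitE x e i : obs_bit i (observe x e) = nth false x (e i).
Proof. by rewrite /obs_bit ffunE ltnS; case: leqP => // /ltnW H; rewrite nth_default. Qed.

(** The order of two pointers is read off a single sweep: [i <= j] means that [j] was not met
    strictly before the cell of [i]. The old [seen] flags are consulted, so marks on the same cell
    count as [<=]. *)
Definition obs_next (o : obs) (c : cellT) : obs :=
  ([ffun i => o.1.1 i || c.2 i],
   [ffun ij => o.1.2 ij || c.2 ij.1 && ~~ o.1.1 ij.2],
   [ffun i => o.2 i || c.2 i && (c.1 == Some true)]).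

Lemma obs_nextE x e p : obs_next (obs_at x e p) (cell x e p) = obs_at x e p.+1.
Proof.
congr (_, _, _); apply/ffunP => i; rewrite !ffunE /=.
- by rewrite ltnS [in RHS]leq_eqVlt orbC.
- by rewrite ltnS; lia.
- case: (ltngtP (e i) p) => [H|H|->] /=; rewrite ?orbF //.
  + by rewrite ltnS (ltnW H).
  + by rewrite ltnS leqNgt H.
  + by rewrite ltnS leqnn; case: ltnP => H; [case: (nth _ _ _) | rewrite nth_default].
Qed.

Lemma obs_at0 x e : obs_at x e 0 = ([ffun=> false], [ffun=> false], [ffun=> false]).
Proof. by congr (_, _, _); apply/ffunP => i; rewrite !ffunE. Qed.

Definition carry_start (a : act) := if a is Zero _ then true else false.

(** The carry [c] tells whether the mark of [i] belongs on the present cell. Moving [i] to the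
    successor of [j] passes the old mark of [j] on to the next cell, which also works for
    [i = j]. *)
Definition rewrite_marks (a : act) (c : bool) (m : {ffun V -> bool}) :
    bool * {ffun V -> bool} :=
  match a with
  | Zero i => (false, [ffun j => if j == i then c else m j])
  | Move i j true => (m j, [ffun j => if j == i then c else m j])
  | Move i j false => (false, [ffun k => if k == i then m j else m k])
  | Out _ => (false, m)
  end.

Definition carry_at (a : act) (e : env) (p : nat) : bool :=
  match a with
  | Zero _ => p == 0
  | Move _ j true => (e j).+1 == p
  | _ => false
  end.

Lemma rewrite_marksE a x s p :
  rewrite_marks a (carry_at a s.1 p) (cell x s.1 p).2 =
  (carry_at a s.1 p.+1, (cell x (do_act a s).1 p).2).
Proof.
by case: a => [i|i j []|b] //=; congr (_, _); rewrite ?ffunE //;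
   apply/ffunP => k; rewrite !ffunE; case: (k == i); rewrite ?addn1 ?addn0 // eq_sym.
Qed.

Definition mconf := (nat * pstate)%type.

Definition mstep (P : seq instr) (x : seq bool) (c : mconf) : mconf :=
  match onth P c.1 with
  | None => c
  | Some (Do a) => (c.1.+1, do_act a c.2)
  | Some (Branch b t) => (if b (observe x c.2.1) then c.1.+1 else t, c.2)
  end.

(** * Compilation of pointer programs to Turing machines *)

Section Compile.
Variable P : seq instr.
Notation PC := 'I_(size P).+1.

(** [Sweep] crosses the input region with the pending carry and the observations so far, [Append]
    goes on to the first blank behind the output, [Return] runs left to the blank before the region,
    and [Finish] crosses the region once more and halts right behind it, where the output begins. *)
Inductive control :=
  | Return of PC
  | Sweep of PC & bool & obs
  | Append of PC & bool
  | Finish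
  | LoadInput.

Definition control_code (q : control) : PC + (PC * bool * obs) + (PC * bool) + bool :=
  match q with
  | Return pc => inl (inl (inl pc))
  | Sweep pc c o => inl (inl (inr (pc, c, o)))
  | Append pc b => inl (inr (pc, b))
  | Finish => inr true
  | LoadInput => inr false
  end.

Definition control_decode (q : PC + (PC * bool * obs) + (PC * bool) + bool) : control :=
  match q with
  | inl (inl (inl pc)) => Return pc
  | inl (inl (inr (pc, c, o))) => Sweep pc c o
  | inl (inr (pc, b)) => Append pc b
  | inr true => Finish
  | inr false => LoadInput
  end.

Lemma control_codeK : cancel control_code control_decode.
Proof. by case. Qed.

HB.instance Definition _ := Finite.copy control (can_type control_codeK).

Notation sym := (asym cellT).
Definition acell (c : cellT) : sym := Some (inr c).
Notation bit := (@abit cellT).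

Definition move (q : control) (a : sym) (right : bool) : option (option control * sym * bool) :=
  Some (Some q, a, right).

Definition append_step (pc : PC) (b : bool) (a : sym) :=
  if a is None then move (Return pc) (bit b) false else move (Append pc b) a true.

Definition sweep_end (pc : PC) (o : obs) (a : sym) :=
  match onth P pc with
  | Some (Do (Out b)) => append_step (inord pc.+1) b a
  | Some (Do _) => move (Return (inord pc.+1)) a false
  | Some (Branch b t) => move (Return (inord (if b o then pc.+1 else t))) a false
  | None => None
  end.

Definition instr_carry (ins : instr) := if ins is Do a then carry_start a else false.

Definition instr_rewrite (ins : instr) c m :=
  if ins is Do a then rewrite_marks a c m else (false, m).

Definition control_step (q : option control) (a : sym) :=
  match q, a with
  | None, Some (inl b) => move LoadInput (acell (Some b, [ffun=> true])) true
  | None, None => move (Return ord0) (acell (None, [ffun=> true])) false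
  | Some LoadInput, Some (inl b) => move LoadInput (acell (Some b, [ffun=> false])) true
  | Some LoadInput, None => move (Return ord0) (acell (None, [ffun=> false])) false
  | Some (Return pc), None =>
      if onth P pc is Some ins
      then move (Sweep pc (instr_carry ins) ([ffun=> false], [ffun=> false], [ffun=> false])) None true
      else move Finish None true
  | Some (Return pc), _ => move (Return pc) a false
  | Some (Sweep pc c o), Some (inr k) =>
      if onth P pc is Some ins then
        let: (c', m) := instr_rewrite ins c k.2 in
        move (Sweep pc c' (obs_next o k)) (acell (k.1, m)) true
      else None
  | Some (Sweep pc c o), _ => sweep_end pc o a
  | Some (Append pc b), _ => append_step pc b a
  | Some Finish, Some (inr k) => move Finish a true
  | _, _ => None
  end.

Notation cstep := (astep control_step).

(** The case [d = 0] is the return after loading, when the blank to the left of the region is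
    created; [d = 1] is every later return, when it already exists. The predecessor [d.-1] covers
    both. *)
Lemma return_left pc s d a r : all isSome s -> isSome a ->
  iter (size s).+1 cstep (Some (Return pc), s ++ nseq d None, a :: r) =
  (Some (Return pc), nseq d.-1 None, None :: catrev s (a :: r)).
Proof.
elim: s a r => [|b s IH] a r /=.
  by case: a => // a _ _; case: a => ?; case: d.
move=> /andP[Hb Hs] Ha; rewrite -iterS iterSr.
by rewrite -(IH b (a :: r)) //; case: a Ha => // -[].
Qed.

Lemma turn_left q pc s d a r : all isSome s -> s != [::] ->
  control_step q (head None r) = move (Return pc) a false ->
  iter (size s).+1 cstep (q, s ++ nseq d None, r) =
  (Some (Return pc), nseq d.-1 None, None :: catrev s (a :: behead r)).
Proof.
case: s => // b s /andP[Hb Hs] _ E.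
by rewrite [size _]/= iterSr {2}/astep E [LHS]return_left.
Qed.

Definition cells x (e : env) := [seq acell (cell x e p) | p <- iota 0 (size x).+1].

Lemma size_cells x e : size (cells x e) = (size x).+1.
Proof. by rewrite size_map size_iota. Qed.

Lemma isSome_cells x e : all isSome (cells x e).
Proof. by apply/allP => a /mapP[p _ ->]. Qed.

(* The machine between two instructions: the head is on the blank to the left
   of the input region, which is followed by the output written so far. *)
Definition home x (pc : PC) (s : pstate) m : aconf control cellT :=
  (Some (Return pc), [::], None :: cells x s.1 ++ map bit s.2 ++ nseq m None).

Definition env0 : env := [ffun=> 0].

Lemma load_right l y :
  iter (size y) cstep (Some LoadInput, l, map bit y) =
  (Some LoadInput, catrev [seq acell (Some b, [ffun=> false]) | b <- y] l, [::]).
Proof. by elim: y l => //= b y IH l; rewrite -iterS iterSr IH. Qed.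

Lemma load x : exists t, t <= 2 * size x + 3 /\
  iter t cstep (None, [::], map bit x) = home x ord0 (env0, [::]) 0.
Proof.
have Ecells b y : cells (b :: y) env0 =
    acell (Some b, [ffun=> true]) ::
    [seq acell (Some b, [ffun=> false]) | b <- y] ++ [:: acell (None, [ffun=> false])].
  have mark0 p : [ffun i => env0 i == p] = [ffun=> p == 0] :> {ffun V -> bool}.
    by apply/ffunP => i; rewrite !ffunE eq_sym.
  rewrite /cells (_ : (size (b :: y)).+1 = 1 + (size y + 1)); last by rewrite addn1.
  rewrite iotaD map_cat.
  congr (_ :: _); first by rewrite /cell mark0.
  rewrite iotaD map_cat; congr (_ ++ _); last first.
    by rewrite /= /cell mark0 /= addSn ltnS add0n ltnn.
  apply: (@eq_from_nth _ None); first by rewrite !size_map size_iota.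
  move=> i; rewrite size_map size_iota => Hi.
  rewrite (nth_map 0) ?size_iota // (nth_map false) // nth_iota //.
  by rewrite /cell mark0 /= ltnS Hi.
case: x => [|b y].
  exists 1; split => //=; rewrite /home /cells /= /cell /=.
  congr (_, _, [:: _; acell (_, _)]).
  by apply/ffunP => i; rewrite !ffunE.
exists ((size y).+2 + (size y).+1); split; first by rewrite /=; lia.
have := load_right [:: acell (Some b, [ffun=> true])] y; set s := catrev _ _ => run.
rewrite iterD [iter (size y).+1 _ _]iterSr [cstep _]/= run.
have Es : size s = (size y).+1.
  by rewrite /s catrevE size_cat size_rev size_map addn1.
rewrite -Es -{2}[s]cats0 (@turn_left _ ord0 s 0 (acell (None, [ffun=> false]))) //.
- by rewrite /home Ecells /= !cats0 /s !catrevE rev_cat revK -catA.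
- by rewrite /s catrevE all_cat all_rev /= andbT; apply/allP => a /mapP[c _ ->].
- by rewrite -size_eq0 Es.
Qed.

Definition instr_env (ins : instr) (s : pstate) := if ins is Do a then do_act a s else s.

Lemma sweep_right x (pc : PC) ins s l r : onth P pc = Some ins ->
  iter (size x).+2 cstep (Some (Return pc), l, None :: cells x s.1 ++ r) =
  (Some (Sweep pc (if ins is Do a then carry_at a s.1 (size x).+1 else false) (observe x s.1)),
   catrev (cells x (instr_env ins s).1) (None :: l), r).
Proof.
move=> Eins; pose cr p := if ins is Do a then carry_at a s.1 p else false.
(* Invariant at cell [p]: the cells before [p] carry their new marks, and the state holds the carry
   into [p] together with the observations of the first [p] cells. *)
suff main k p l' : iter k cstep (Some (Sweep pc (cr p) (obs_at x s.1 p)), l',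
     [seq acell (cell x s.1 p) | p <- iota p k] ++ r) =
   (Some (Sweep pc (cr (p + k)) (obs_at x s.1 (p + k))),
    catrev [seq acell (cell x (instr_env ins s).1 p) | p <- iota p k] l', r).
  rewrite iterSr (_ : cstep _ = (Some (Sweep pc (cr 0) (obs_at x s.1 0)), None :: l,
                                 cells x s.1 ++ r)); first exact: main.
  have -> : cr 0 = instr_carry ins by rewrite /cr; case: (ins) => // -[|? ? []|].
  by rewrite /astep [head _ _]/= [behead _]/= /control_step Eins obs_at0.
elim: k p l' => [|k IH] p l'; first by rewrite addn0.
rewrite iterSr [iota _ _]/= [map _ (_ :: _)]/= [map _ (_ :: _)]/= cat_cons.
rewrite {2}/astep [head _ _]/= [behead _]/= /control_step /acell Eins.
have -> : instr_rewrite ins (cr p) (cell x s.1 p).2 =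
    (cr p.+1, (cell x (instr_env ins s).1 p).2).
  by rewrite /cr; case: (ins) => //= a; exact: (rewrite_marksE a x s p).
by rewrite obs_nextE /move IH addSnnS.
Qed.

Lemma append_right pc b l y m :
  iter (size y) cstep (Some (Append pc b), l, map bit y ++ nseq m None) =
  (Some (Append pc b), catrev (map bit y) l, nseq m None).
Proof. by elim: y l => //= c y IH l; rewrite -iterS iterSr IH. Qed.

Lemma return_home q pc a w r : all isSome w -> w != [::] ->
  control_step q (head None r) = move (Return pc) a false ->
  iter (size w).+1 cstep (q, rev w ++ [:: None], r) =
  (Some (Return pc), [::], None :: w ++ a :: behead r).
Proof.
move=> Hw w0 E; rewrite -size_rev -[[:: None]]/(nseq 1 None) (turn_left _ _ _ E) ?all_rev //.
  by rewrite catrevE revK.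
by rewrite -size_eq0 size_rev size_eq0.
Qed.

Lemma simulate_step x (pc : PC) s m : pc < size P ->
  exists t m', t <= 2 * (size x + size s.2) + 6 /\
    iter t cstep (home x pc s m) =
    home x (inord (mstep P x (nat_of_ord pc, s)).1) (mstep P x (nat_of_ord pc, s)).2 m'.
Proof.
move=> Hpc; rewrite /mstep /=.
case Eins: (onth P pc) => [ins|]; last by move: Hpc; rewrite -onthTE Eins.
have sweep := sweep_right x s [::] (map bit s.2 ++ nseq m None) Eins.
rewrite catrevE in sweep; set q := Some (Sweep _ _ _) in sweep.
have cells_n0 e : cells x e != [::] by rewrite -size_eq0 size_cells.
have Eq y : control_step q (head None (map bit y ++ nseq m None)) =
            sweep_end pc (observe x s.1) (head None (map bit y ++ nseq m None)).
  by case: y => [|b y] //=; case: (m).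
have plain pc' : (instr_env ins s).2 = s.2 ->
  (forall a, sweep_end pc (observe x s.1) a = move (Return pc') a false) ->
  exists t m', t <= 2 * (size x + size s.2) + 6 /\
    iter t cstep (home x pc s m) = home x pc' (instr_env ins s) m'.
  (* With empty output the head turns on the first trailing blank and writes it explicitly, so one
     blank is present afterwards even if [m] was 0. *)
  move=> Es Hend; exists ((size x).+2 + (size x).+2), (if s.2 is [::] then m.-1.+1 else m).
  split; first by lia.
  rewrite iterD sweep -[in X in iter X _ _](size_cells x (instr_env ins s).1).
  rewrite (return_home (isSome_cells _ _) (cells_n0 _) (etrans (Eq s.2) (Hend _))) /home Es.
  by case: (s.2) => //; case: (m).
clearbody q; case: ins Eins sweep plain Eq => [[i|i j b|b]|b t] Eins sweep plain Eq /=.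
- by apply: plain => // a; rewrite /sweep_end Eins.
- by apply: plain => // a; rewrite /sweep_end Eins.
- change (instr_env _ s).1 with s.1 in sweep; case Es: s.2 Eq sweep => [|c y] Eq sweep.
    exists ((size x).+2 + (size x).+2), m.-1; split; first by lia.
    rewrite iterD /home Es sweep -[in X in iter X _ _](size_cells x s.1).
    rewrite (@return_home _ (inord pc.+1) (bit b)) ?isSome_cells //; first by case: (m).
    by rewrite Eq /sweep_end Eins; case: (m).
  set w := cells x s.1 ++ map bit (c :: y).
  exists ((size w).+1 + (size y + (1 + (size x).+2))), m.-1; split.
    by rewrite /w size_cat size_cells size_map /=; lia.
  have step1 : iter 1 cstep (q, rev (cells x s.1) ++ [:: None], map bit (c :: y) ++ nseq m None) =
      (Some (Append (inord pc.+1) b), bit c :: rev (cells x s.1) ++ [:: None],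
       map bit y ++ nseq m None).
    by have := Eq (c :: y); rewrite /= /sweep_end Eins /= => ->.
  rewrite 2!iterD [iter (1 + _) _ _]iterD /home Es sweep step1 append_right.
  have -> : catrev (map bit y) (Some (inl c) :: rev (cells x s.1) ++ [:: None]) =
      rev w ++ [:: None].
    by rewrite catrevE /w rev_cat /= rev_cons -cats1 -!catA.
  rewrite (@return_home _ (inord pc.+1) (bit b)).
  + rewrite /w /= map_rcons -cats1 -!catA /=.
    by case: (m).
  + by rewrite /w all_cat isSome_cells; apply/allP => a /mapP[d _ ->].
  + by rewrite -size_eq0 /w size_cat size_cells.
  + by case: (m).
- by apply: plain => // a; rewrite /sweep_end Eins.
Qed.

(** The machine stores the program counter through [inord], which is faithful only for targets up to
    [size P]; the target [size P] itself means that the program is over. *)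
Definition targets_le (n : nat) (p : seq instr) :=
  all (fun ins => if ins is Branch _ t then t <= n else true) p.

Lemma mstep_le x c : targets_le (size P) P -> c.1 <= size P -> (mstep P x c).1 <= size P.
Proof.
move=> Hok Hc; rewrite /mstep; case E: (onth P c.1) => [ins|] //.
have lt_c : c.1 < size P by rewrite -onthTE E.
have := all_nthP ins Hok _ lt_c; rewrite (onth_nth ins _ _ _ E).
by case: ins {E} => //= b t; case: ifP.
Qed.

Lemma simulate x k : targets_le (size P) P ->
  let c := iter k (mstep P x) (0, (env0, [::])) in
  exists t m, [/\ t <= 2 * size x + 3 + k * (2 * (size x + k) + 6),
    iter t cstep (None, [::], map bit x) = home x (inord c.1) c.2 m,
    c.1 <= size P & size c.2.2 <= k].
Proof.
move=> Hok; elim: k => [|k /= [t [m [Ht Hrun Hpc Hout]]]].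
  have [t [Ht Hrun]] := load x; exists t, 0; split=> //; first by lia.
  by rewrite Hrun /=; congr (home _ _ _ _); apply/val_inj; rewrite /= inordK.
set c := iter k _ _ in Hrun Hpc Hout *.
have Hpc' := mstep_le x Hok Hpc.
have Hout' : size (mstep P x c).2.2 <= k.+1.
  rewrite /mstep; case: (onth P c.1) => [[[i|i j b|b]|b t']|] /=; rewrite ?size_rcons; lia.
case: (ltnP c.1 (size P)) => Hlt; last first.
  exists t, m; split=> //; first by nia.
  by rewrite Hrun /mstep onth_default.
have Einord : nat_of_ord (inord c.1 : PC) = c.1 by rewrite inordK.
have [|t' [m' [Ht' Hrun']]] := @simulate_step x (inord c.1) c.2 m; first by rewrite Einord.
exists (t' + t), m'; split=> //; first by nia.
by rewrite iterD Hrun Hrun' Einord -surjective_pairing.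
Qed.

Lemma finish_right l x e r :
  iter (size (cells x e)) cstep (Some Finish, l, cells x e ++ r) =
  (Some Finish, catrev (cells x e) l, r).
Proof.
rewrite /cells; elim: (iota _ _) l => //= p s IH l.
by rewrite -iterS iterSr IH.
Qed.

Lemma code_poly_computable (g : seq bool -> seq bool) (B : nat -> nat) :
  poly_bounded B -> targets_le (size P) P ->
  (forall x, exists k e, k <= B (size x) /\
     iter k (mstep P x) (0, (env0, [::])) = (size P, (e, g x))) ->
  poly_computable g.
Proof.
move=> HB Hok H.
apply: (@abstract_poly_computable _ _ control_step _
  (fun n => 2 * n + 3 + B n * (2 * (n + B n) + 6) + (n + 2))).
  by repeat (apply: poly_bounded_add || apply: poly_bounded_mul ||
    apply: poly_bounded_const || apply: poly_bounded_id || apply: HB).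
move=> x; have [k [e [Hk Ek]]] := H x.
have [t [m [Ht]]] := simulate x k Hok; rewrite Ek /= => Hrun _ _.
(* The last [size x + 2] steps leave the left blank and cross the [size x + 1] cells, so that the
   head stops on the first output bit. *)
exists ((size x).+2 + t), (Some Finish), (catrev (cells x e) [:: None]), m; split.
- by rewrite addnC leq_add ?addn2 // (leq_trans Ht) // leq_add2l; nia.
- rewrite iterD Hrun /home iterSr -[in X in iter X _ _](size_cells x e).
  by rewrite -finish_right {2}/astep [head _ _]/= /control_step onth_default ?inordK.
- by case: (g x) => [|b y] /=; [case: (m) | ].
Qed.

End Compile.
End PointerMachine.

(** * Loop programs *)

Section LoopPrograms.
Variable V : finType.
Notation obs := (obs V).
Notation pstate := (pstate V).
Notation env := (env V).

(* [For h c] runs [c] with [h] at each position 0, ..., |x| of the input [x],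
   including the end position |x|. *)
Inductive cmd :=
  | Skip
  | Act of act V
  | Seq of cmd & cmd
  | If of (obs -> bool) & cmd & cmd
  | For of V & cmd.

Definition set_var (i : V) (v : nat) (s : pstate) : pstate := (upd s.1 i v, s.2).

Fixpoint run (x : seq bool) (c : cmd) (s : pstate) : pstate :=
  match c with
  | Skip => s
  | Act a => do_act a s
  | Seq c1 c2 => run x c2 (run x c1 s)
  | If b c1 c2 => if b (observe x s.1) then run x c1 s else run x c2 s
  | For h c => set_var h (size x).+1
      (foldl (fun s t => run x c (set_var h t s)) s (iota 0 (size x).+1))
  end.

Lemma run_Seq x c1 c2 s : run x (Seq c1 c2) s = run x c2 (run x c1 s).
Proof. by []. Qed.

Lemma run_If x b c1 c2 s :
  run x (If b c1 c2) s = if b (observe x s.1) then run x c1 s else run x c2 s.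
Proof. by []. Qed.

Definition act_writes (a : act V) : seq V :=
  match a with Zero i => [:: i] | Move i _ _ => [:: i] | Out _ => [::] end.

Fixpoint writes (c : cmd) : seq V :=
  match c with
  | Skip => [::]
  | Act a => act_writes a
  | Seq c1 c2 => writes c1 ++ writes c2
  | If _ c1 c2 => writes c1 ++ writes c2
  | For h c => h :: writes c
  end.

(** A loop body may not write its own loop variable, so every loop makes exactly [size x + 1] rounds
    and the running time is bounded in advance. *)
Fixpoint well_formed (c : cmd) : bool :=
  match c with
  | Seq c1 c2 => well_formed c1 && well_formed c2
  | If _ c1 c2 => well_formed c1 && well_formed c2
  | For h c => (h \notin writes c) && well_formed c
  | _ => true
  end.

Fixpoint silent (c : cmd) : bool :=
  match c with
  | Act (Out _) => false
  | Seq c1 c2 => silent c1 && silent c2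
  | If _ c1 c2 => silent c1 && silent c2
  | For h c => silent c
  | _ => true
  end.

Lemma updE (e : env) i v j : upd e i v j = if j == i then v else e j.
Proof. by rewrite ffunE. Qed.

Lemma upd_same (e : env) i : upd e i (e i) = e.
Proof. by apply/ffunP => j; rewrite updE; case: eqP => [->|]. Qed.

Lemma upd_upd (e : env) i v w : upd (upd e i v) i w = upd e i w.
Proof. by apply/ffunP => j; rewrite !updE; case: eqP. Qed.

Lemma set_var_set_var i v w s : set_var i w (set_var i v s) = set_var i w s.
Proof. by rewrite /set_var /= upd_upd. Qed.

Lemma set_var_same i v (s : pstate) : s.1 i = v -> set_var i v s = s.
Proof. by case: s => e o /= <-; rewrite /set_var /= upd_same. Qed.

Lemma foldl_invariant (T S : Type) (I : S -> Prop) (f : S -> T -> S) s r :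
  I s -> (forall s t, I s -> I (f s t)) -> I (foldl f s r).
Proof. by move=> Is If; elim: r s Is => //= t r IH s Is; exact/IH/If. Qed.

Lemma run_frame x c (s : pstate) i : i \notin writes c -> (run x c s).1 i = s.1 i.
Proof.
elim: c s => [|a|c1 IH1 c2 IH2|b c1 IH1 c2 IH2|h c IH] s /=.
- by [].
- by case: a => [j|j k b|b] //=; rewrite inE updE => /negPf->.
- by rewrite mem_cat negb_or => /andP[H1 H2]; rewrite IH2 ?IH1.
- by rewrite mem_cat negb_or => /andP[H1 H2]; case: ifP; rewrite ?IH2 ?IH1.
- rewrite inE negb_or updE => /andP[/negPf Hh Hc]; rewrite Hh.
  apply: (@foldl_invariant _ _ (fun s' : pstate => s'.1 i = s.1 i)).
    by rewrite IH //= updE Hh.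
  by move=> s' t <-; rewrite IH //= updE Hh.
Qed.

Lemma run_silent x c s : silent c -> (run x c s).2 = s.2.
Proof.
elim: c s => [|a|c1 IH1 c2 IH2|b c1 IH1 c2 IH2|h c IH] s /=.
- by [].
- by case: a.
- by move=> /andP[H1 H2]; rewrite IH2 ?IH1.
- by move=> /andP[H1 H2]; case: ifP; rewrite ?IH2 ?IH1.
- move=> Hc; apply: (@foldl_invariant _ _ (fun s' : pstate => s'.2 = s.2)).
    by rewrite IH.
  by move=> s' t <-; rewrite IH.
Qed.

Fixpoint code_size (c : cmd) : nat :=
  match c with
  | Skip => 0
  | Act _ => 1
  | Seq c1 c2 => code_size c1 + code_size c2
  | If _ c1 c2 => code_size c1 + code_size c2 + 2
  | For _ c => code_size c + 4
  end.

Definition goto (t : nat) : instr V := Branch (fun=> false) t.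

(** A loop is a reset, a test, the body, an increment and a jump back to the test. The test is
    [obs_seen]: it fails as soon as [h] has left the input region. *)
Fixpoint code (o : nat) (c : cmd) : seq (instr V) :=
  match c with
  | Skip => [::]
  | Act a => [:: Do a]
  | Seq c1 c2 => code o c1 ++ code (o + code_size c1) c2
  | If b c1 c2 =>
      Branch b (o + code_size c1 + 2) :: code o.+1 c1 ++
      goto (o + code_size c1 + code_size c2 + 2) :: code (o + code_size c1 + 2) c2
  | For h c =>
      [:: Do (Zero h), Branch (@obs_seen V h) (o + code_size c + 4) & code (o + 2) c ++
      [:: Do (Move h h true); goto o.+1]]
  end.

Lemma size_code o c : size (code o c) = code_size c.
Proof.
elim: c o => [|a|c1 IH1 c2 IH2|b c1 IH1 c2 IH2|h c IH] o //=.
- by rewrite size_cat IH1 IH2.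
- by rewrite size_cat /= IH1 IH2; lia.
- by rewrite size_cat /= IH; lia.
Qed.

Lemma targets_leW m n (p : seq (instr V)) : m <= n -> targets_le m p -> targets_le n p.
Proof. by move=> Hmn; apply: sub_all => -[] //= b t Ht; exact: leq_trans Hmn. Qed.

Lemma targets_code o c : targets_le (o + code_size c) (code o c).
Proof.
rewrite /targets_le.
elim: c o => [|a|c1 IH1 c2 IH2|b c1 IH1 c2 IH2|h c IH] o //=.
- rewrite all_cat; apply/andP; split.
  + by apply: targets_leW (IH1 o); lia.
  + by apply: targets_leW (IH2 _); lia.
- rewrite all_cat /=; apply/and4P; split; try lia.
  + by apply: targets_leW (IH1 _); lia.
  + by apply: targets_leW (IH2 _); lia.
- rewrite all_cat /=; apply/and3P; split; try lia.
  by apply: targets_leW (IH _); lia.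
Qed.

(** Charging both branches of a conditional avoids a maximum. In a loop, 3 per round pays for the
    test, the increment and the jump back, and the final 2 for the reset and the failing test. *)
Fixpoint cost (c : cmd) (n : nat) : nat :=
  match c with
  | Skip => 0
  | Act _ => 1
  | Seq c1 c2 => cost c1 n + cost c2 n
  | If _ c1 c2 => cost c1 n + cost c2 n + 2
  | For _ c => (n + 1) * (cost c n + 3) + 2
  end.

Lemma cost_poly_bounded c : poly_bounded (cost c).
Proof.
elim: c => [|a|c1 IH1 c2 IH2|b c1 IH1 c2 IH2|h c IH] /=;
by repeat (apply: poly_bounded_add || apply: poly_bounded_mul ||
    apply: poly_bounded_const || apply: poly_bounded_id || assumption).
Qed.

Lemma onth_code (pre : seq (instr V)) ins post i :
  i = size pre -> onth (pre ++ ins :: post) i = Some ins.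
Proof. by move->; rewrite onth_cat ltnn subnn. Qed.

Lemma run_code x P pre post c s : well_formed c ->
  P = pre ++ code (size pre) c ++ post ->
  exists k, k <= cost c (size x) /\
    iter k (mstep P x) (size pre, s) = (size pre + code_size c, run x c s).
Proof.
elim: c pre post s => [|a|c1 IH1 c2 IH2|b c1 IH1 c2 IH2|h c IH] pre post s /=.
- by exists 0; rewrite addn0.
- by move=> _ EP; exists 1; rewrite /= /mstep /= EP onth_code // addn1.
- move=> /andP[wf1 wf2] EP.
  have [|k1 [Hk1 E1]] := IH1 pre (code (size pre + code_size c1) c2 ++ post) s wf1.
    by rewrite EP -catA.
  have [|k2 [Hk2 E2]] := IH2 (pre ++ code (size pre) c1) post (run x c1 s) wf2.
    by rewrite EP size_cat size_code -!catA.
  exists (k2 + k1); split; first by lia.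
  by rewrite iterD E1; move: E2; rewrite size_cat size_code addnA.
- move=> /andP[wf1 wf2] EP; set o := size pre in EP *.
  pose cond := Branch b (o + code_size c1 + 2).
  pose skip2 := goto (o + code_size c1 + code_size c2 + 2).
  have first : mstep P x (o, s) =
      (if b (observe x s.1) then o.+1 else o + code_size c1 + 2, s).
    by rewrite /mstep EP onth_code.
  case Eb: (b _) first => first.
    have [|k1 [Hk1 E1]] := IH1 (rcons pre cond)
      (skip2 :: code (o + code_size c1 + 2) c2 ++ post) s wf1.
      by rewrite EP cat_rcons size_rcons /= -catA.
    exists (1 + (k1 + 1)); split; first by lia.
    rewrite !iterD /= first; move: E1; rewrite size_rcons => ->.
    have EP1 : P = (rcons pre cond ++ code o.+1 c1) ++ skip2 ::
        code (o + code_size c1 + 2) c2 ++ post.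
      by rewrite EP -!catA cat_rcons /= -?catA.
    rewrite /mstep EP1 onth_code /=; first by congr (_, _); lia.
    by rewrite size_cat size_rcons size_code -/o; lia.
  have [|k2 [Hk2 E2]] := IH2 (pre ++ cond :: code o.+1 c1 ++ [:: skip2]) post s wf2.
    rewrite EP size_cat /= size_cat size_code /= -!catA /= -!catA /= -/o.
    by rewrite (_ : o + (code_size c1 + 1).+1 = o + code_size c1 + 2) //; lia.
  exists (k2 + 1); split; first by lia.
  rewrite iterD /= first; move: E2; rewrite size_cat /= size_cat size_code /= -/o.
  have -> : o + (code_size c1 + 1).+1 = o + code_size c1 + 2 by lia.
  by move->; congr (_, _); lia.
- move=> /andP[Hh wf] EP; set o := size pre in EP *.
  set n := size x; pose body s t := run x c (set_var h t s).
  (* The previous value of [h] is overwritten by the first round or, if none is left, by the final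
     assignment. This reconciles the increments of the machine with [run], which assigns [h] in
     every round. *)
  have body_set s1 t m : set_var h n.+1 (foldl body s1 (iota t m)) =
      set_var h n.+1 (foldl body (set_var h t s1) (iota t m)).
    by case: m => [|m] /=; rewrite ?set_var_set_var // {4}/body set_var_set_var.
  have at1 : onth P o.+1 = Some (Branch (@obs_seen V h) (o + code_size c + 4)).
    by rewrite EP -cat_rcons onth_code // size_rcons.
  have EP2 : P = (pre ++ [:: Do (Zero h); Branch (@obs_seen V h) (o + code_size c + 4)] ++
      code (o + 2) c) ++ [:: Do (Move h h true), goto o.+1 & post].
    by rewrite EP -!catA /= -?catA.
  have at2 : onth P (o + 2 + code_size c) = Some (Do (Move h h true)).
    by rewrite EP2 onth_code // !size_cat size_code addnA.
  have at3 : onth P (o + 2 + code_size c).+1 = Some (goto o.+1).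
    by rewrite EP2 -cat_rcons onth_code // size_rcons !size_cat size_code addnA.
  (* Here [m] rounds are left and the machine is at the test with [h] at [t]. *)
  have loop m t (s' : pstate) : t + m = n.+1 -> s'.1 h = t -> exists k, k <= m * (cost c n + 3) + 1 /\
      iter k (mstep P x) (o.+1, s') =
      (o + code_size c + 4, set_var h n.+1 (foldl body s' (iota t m))).
    elim: m t s' => [|m IHm] t s' Et Es'.
      rewrite addn0 in Et; rewrite {}Et in Es'.
      exists 1; split=> //; rewrite /= /mstep at1 /= obs_seenE Es' ltnn.
      by rewrite set_var_same.
    have [|k1 [Hk1 E1]] := IH (pre ++ [:: Do (Zero h); Branch (@obs_seen V h) (o + code_size c + 4)])
       ([:: Do (Move h h true); goto o.+1] ++ post) s' wf.
      by rewrite EP size_cat -!catA /= -?catA.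
    have Eh : (run x c s').1 h = t by rewrite run_frame.
    have [k2 [Hk2 E2]] := IHm t.+1 (set_var h t.+1 (run x c s')) ltac:(lia)
      ltac:(by rewrite /= updE eqxx).
    have enter : mstep P x (o.+1, s') = (o + 2, s').
      by rewrite /mstep at1 /= obs_seenE Es' addn2 (_ : t <= size x) // -/n; lia.
    have next : mstep P x (o + 2 + code_size c, run x c s') =
        ((o + 2 + code_size c).+1, set_var h t.+1 (run x c s')).
      by rewrite /mstep at2 /= Eh addn1.
    have again s1 : mstep P x ((o + 2 + code_size c).+1, s1) = (o.+1, s1).
      by rewrite /mstep at3.
    rewrite size_cat /= -/o in E1; rewrite -/n in Hk1.
    exists (k2 + k1.+3); split; first by rewrite mulSn; lia.
    rewrite iterD 2!iterS iterSr enter E1 next again E2.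
    have -> : run x c s' = body s' t by rewrite /body set_var_same.
    by rewrite -body_set.
  have [k [Hk E]] := loop n.+1 0 (set_var h 0 s) erefl ltac:(by rewrite /= updE eqxx).
  exists (k + 1); split; first by rewrite -/n addn1; lia.
  rewrite iterD [iter 1 _ _]/= {2}/mstep EP onth_code // -EP E -addnA.
  by rewrite [RHS]/= -[X in (_, X) = _]body_set.
Qed.

Lemma loop_poly_computable (c : cmd) : well_formed c ->
  poly_computable (fun x => (run x c (env0 V, [::])).2).
Proof.
move=> wf; apply: (@code_poly_computable _ (code 0 c) _ _ (cost_poly_bounded c)).
  by rewrite size_code; exact: targets_code.
move=> x; have [|k [Hk E]] := @run_code x (code 0 c) [::] [::] c (env0 V, [::]) wf.
  by rewrite cats0.
exists k, (run x c (env0 V, [::])).1; split=> //.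
by rewrite E size_code -surjective_pairing.
Qed.
End LoopPrograms.

(** * The pair graph *)

(* Vertices are ordered pairs; (u, u) stands for the vertex u and for an edge uv
   the path (u, u), (u, v), (v, u), (v, v) is the threefold subdivision of uv.
   The first case makes the pair graph symmetric and loopless exactly when [a] is. *)
Definition pair_adj (a : nat -> nat -> bool) (u v w z : nat) : bool :=
  if (u == z) && (v == w) then a u v
  else (w == z) && ((u == w) || (u == v)) || (u == v) && (u == w).

Definition pair_rel n (a : nat -> nat -> bool) (p q : nat) : bool :=
  pair_adj a (p %/ n) (p %% n) (q %/ n) (q %% n).

Definition pair_graph (G : graph) : graph :=
  let n := gn G in
  Graph (n * n) (mkseq (fun k => pair_rel n (gedge G) (k %/ (n * n)) (k %% (n * n)))
                       (n * n * (n * n))).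

Lemma pair_graphE G p q : p < gn G * gn G -> q < gn G * gn G ->
  gedge (pair_graph G) p q = pair_rel (gn G) (gedge G) p q.
Proof.
move=> Hp Hq; rewrite /gedge /= nth_mkseq; last by nia.
by rewrite divnMDl ?modnMDl ?divn_small ?modn_small ?addn0 //; lia.
Qed.

Lemma divn_index n u v : v < n -> (u * n + v) %/ n = u.
Proof. by move=> Hv; rewrite divnMDl ?divn_small ?addn0 //; lia. Qed.

Lemma modn_index n u v : v < n -> (u * n + v) %% n = v.
Proof. by move=> Hv; rewrite modnMDl modn_small. Qed.

Lemma index_lt n u v : u < n -> v < n -> u * n + v < n * n.
Proof. by nia. Qed.

Lemma pair_rel_index n a u v w z : v < n -> z < n ->
  pair_rel n a (u * n + v) (w * n + z) = pair_adj a u v w z.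
Proof. by move=> Hv Hz; rewrite /pair_rel !divn_index ?modn_index. Qed.

Lemma index_inj n p q : p %/ n = q %/ n -> p %% n = q %% n -> p = q.
Proof. by move=> E1 E2; rewrite (divn_eq p n) (divn_eq q n) E1 E2. Qed.

Lemma divn_lt n p : p < n * n -> p %/ n < n.
Proof. by case: n => // n H; rewrite ltn_divLR. Qed.

Lemma modn_lt n p : p < n * n -> p %% n < n.
Proof. by case: n => // n _; rewrite ltn_mod. Qed.

Definition sym_irrefl n (a : nat -> nat -> bool) :=
  forall i j, i < n -> j < n -> a i j = a j i /\ ~~ a i i.

(** This equivalence replaces a simplicity test in the reduction. From left to right, the entry at
    (i, j), (j, i) is [gedge G i j], so symmetry and absence of loops can be read off. *)
Lemma pair_graph_simple G : simple_graph (pair_graph G) <-> sym_irrefl (gn G) (gedge G).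
Proof.
split=> [[_ H] i j Hi Hj|H].
  have E u v := index_lt (n := gn G) (u := u) (v := v).
  have [H1 _] := H _ _ (E i j Hi Hj) (E j i Hj Hi).
  have [_ H2] := H _ _ (E i i Hi Hi) (E i i Hi Hi).
  move: H1 H2; rewrite !pair_graphE ?E // !pair_rel_index //.
  by rewrite /pair_adj !eqxx.
split=> [|p q Hp Hq]; first by rewrite size_mkseq.
rewrite !pair_graphE //; rewrite /= in Hp Hq; split.
  have [E _] := H _ _ (divn_lt Hp) (modn_lt Hp).
  rewrite /pair_rel /pair_adj; move: (p %/ _) (p %% _) (q %/ _) (q %% _) E => u v w z E.
  case: ifP => [/andP[/eqP<- /eqP<-]|H1]; last by case: ifP; lia.
  by rewrite !eqxx E.
have [_ E] := H _ _ (divn_lt Hp) (modn_lt Hp).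
rewrite /pair_rel /pair_adj; move: (p %/ _) (p %% _) E => u v E.
by case: ifP => [/andP[/eqP<-]|] //; lia.
Qed.

Section PairAdjacency.
Variables (a : nat -> nat -> bool) (n : nat).
Notation E := (pair_rel n a).
Notation diag p := (p %/ n == p %% n).

Lemma diag_adj p q : diag p -> diag q -> p <> q -> E p q.
Proof.
move=> /eqP Hp /eqP Hq ne; rewrite /pair_rel /pair_adj -Hp -Hq !eqxx orbT andbT.
case: eqP => // E1; case: ne; apply: (@index_inj n); congruence.
Qed.

Lemma nondiag_nbr p q : ~~ diag p -> E p q ->
  (q %/ n = p %/ n /\ q %% n = p %/ n) \/ (q %/ n = p %% n /\ q %% n = p %/ n).
Proof.
rewrite /pair_rel /pair_adj; move: (p %/ n) (p %% n) (q %/ n) (q %% n) => u v w z.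
by case: ifP; lia.
Qed.

Lemma nondiag_two_nbrs p q1 q2 q3 : ~~ diag p -> E p q1 -> E p q2 -> E p q3 ->
  [\/ q1 = q2, q1 = q3 | q2 = q3].
Proof.
move=> Hp /(nondiag_nbr Hp)[] [H1 H1'] /(nondiag_nbr Hp)[] [H2 H2'] /(nondiag_nbr Hp)[] [H3 H3'];
 first [ by constructor 1; apply: (@index_inj n); congruence
       | by constructor 2; apply: (@index_inj n); congruence
       | by constructor 3; apply: (@index_inj n); congruence ].
Qed.

Lemma nondiag_nondiag p q : ~~ diag p -> ~~ diag q -> E p q ->
  [/\ q %/ n = p %% n, q %% n = p %/ n & a (p %/ n) (p %% n)].
Proof.
rewrite /pair_rel /pair_adj; move: (p %/ n) (p %% n) (q %/ n) (q %% n) => u v w z.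
by move=> Hp Hq; case: ifP => [/andP[/eqP<- /eqP<-] // | H1 H2]; exfalso; lia.
Qed.

(** An off-diagonal (u, v) can only be adjacent to (u, u) and (v, u), and these are not adjacent to
    each other, since (v, u) is attached to (v, v). *)
Lemma triangle_diag p q r : E p q -> E p r -> E q r -> p <> q -> p <> r -> q <> r -> diag p.
Proof.
move=> Hpq Hpr Hqr npq npr nqr; apply/negPn/negP => Hp.
have ne q1 r1 : q1 %/ n = r1 %/ n -> q1 %% n = r1 %% n -> q1 <> r1 -> False.
  by move=> E1 E2; apply; exact: index_inj E1 E2.
move: (ne q r) (nondiag_nbr Hp Hpq) (nondiag_nbr Hp Hpr) Hqr.
rewrite /pair_rel /pair_adj; move: Hp.
move: (p %/ n) (p %% n) (q %/ n) (q %% n) (r %/ n) (r %% n) => u v w z w' z'.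
by case: ifP; lia.
Qed.

(** Off the diagonal, (u, v) can only be adjacent to (v, u), so the graph induced there has maximum
    degree 1. *)
Lemma P3_diag p q r : E q p -> E q r -> p <> r -> [|| diag p, diag q | diag r].
Proof.
move=> Hqp Hqr ne; apply/negPn/negP; rewrite !negb_or => /and3P[Hp Hq Hr].
have [H1 H2 _] := nondiag_nondiag Hq Hp Hqp.
have [H3 H4 _] := nondiag_nondiag Hq Hr Hqr.
by case: ne; apply: (@index_inj n); congruence.
Qed.

End PairAdjacency.

Lemma pair_graph_free G : diamond_2P3_free (pair_graph G).
Proof.
set n := gn G; set a := gedge G.
have edgeE (k : nat) (f : 'I_k -> 'I_(n * n)) i j :
    gedge (pair_graph G) (f i) (f j) = pair_rel n a (f i) (f j).
  by rewrite pair_graphE.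
have ne (k : nat) (f : 'I_k -> 'I_(n * n)) : injective f ->
    forall i j, i != j -> nat_of_ord (f i) <> f j.
  by move=> inj i j /eqP Hij /val_inj /inj.
split=> -[f [inj Hf]].
- pose o k : 'I_4 := inord k.
  have v k : k < 4 -> nat_of_ord (o k) = k by move=> H; rewrite inordK.
  have no i j : i < 4 -> j < 4 -> i != j -> nat_of_ord (f (o i)) <> f (o j).
    by move=> Hi Hj Hij; apply: ne => //; rewrite -val_eqE /= !v.
  have ed i j : i < 4 -> j < 4 ->
      pair_rel n a (f (o i)) (f (o j)) = gedge diamond i j.
    by move=> Hi Hj; rewrite -edgeE -Hf !v.
  (* The two nonadjacent vertices 2 and 3 of the diamond each form a triangle with 0 and 1, so both
     lie in the clique and would be adjacent. *)
  have d2 := triangle_diag (etrans (ed 2 0 isT isT) erefl) (etrans (ed 2 1 isT isT) erefl)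
    (etrans (ed 0 1 isT isT) erefl) (no 2 0 isT isT isT) (no 2 1 isT isT isT) (no 0 1 isT isT isT).
  have d3 := triangle_diag (etrans (ed 3 0 isT isT) erefl) (etrans (ed 3 1 isT isT) erefl)
    (etrans (ed 0 1 isT isT) erefl) (no 3 0 isT isT isT) (no 3 1 isT isT isT) (no 0 1 isT isT isT).
  by have := diag_adj a d2 d3 (no 2 3 isT isT isT); rewrite ed.
- pose o k : 'I_6 := inord k.
  have v k : k < 6 -> nat_of_ord (o k) = k by move=> H; rewrite inordK.
  have no i j : i < 6 -> j < 6 -> i != j -> nat_of_ord (f (o i)) <> f (o j).
    by move=> Hi Hj Hij; apply: ne => //; rewrite -val_eqE /= !v.
  have ed i j : i < 6 -> j < 6 ->
      pair_rel n a (f (o i)) (f (o j)) = gedge twoP3 i j.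
    by move=> Hi Hj; rewrite -edgeE -Hf !v.
  have := P3_diag (etrans (ed 1 0 isT isT) erefl) (etrans (ed 1 2 isT isT) erefl) (no 0 2 isT isT isT).
  have := P3_diag (etrans (ed 4 3 isT isT) erefl) (etrans (ed 4 5 isT isT) erefl) (no 3 5 isT isT isT).
  have far i j : f (o i) %/ n == f (o i) %% n -> f (o j) %/ n == f (o j) %% n ->
      i < 6 -> j < 6 -> i != j -> ~~ gedge twoP3 i j -> False.
    by move=> di dj Hi Hj Hij; rewrite -ed // (diag_adj a di dj (no _ _ Hi Hj Hij)).
  by move=> /or3P[] d1 /or3P[] d2; apply: (far _ _ d2 d1).
Qed.

(** * Isomorphisms between pair graphs *)

Definition iso_maps (G H : graph) (f g : nat -> nat) :=
  [/\ forall i, i < gn G -> f i < gn H /\ g (f i) = i,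
      forall j, j < gn H -> g j < gn G /\ f (g j) = j
    & forall i j, i < gn G -> j < gn G -> gedge G i j = gedge H (f i) (f j)].

Lemma iso_maps_sym G H f g : iso_maps G H f g -> iso_maps H G g f.
Proof.
move=> [Hf Hg He]; split=> // i j Hi Hj.
have [Hgi Ei] := Hg _ Hi; have [Hgj Ej] := Hg _ Hj.
by rewrite He // Ei Ej.
Qed.

(** Functions on plain numbers let a vertex of the pair graph be split by division, without casts
    between the ordinal types of the two graphs. *)
Lemma isomorphicP G H :
  isomorphic G H <-> gn G = gn H /\ exists f g, iso_maps G H f g.
Proof.
split=> [[f [[g fK gK] He]]|[En [f [g [Hf Hg He]]]]].
  split; first by have := bij_eq_card (Bijective fK gK); rewrite !card_ord.
  exists (fun i => oapp (fun o => nat_of_ord (f o)) 0 (insub i)).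
  exists (fun i => oapp (fun o => nat_of_ord (g o)) 0 (insub i)); split.
  - by move=> i Hi; rewrite (insubT (fun i => i < gn G) Hi) /= valK /= fK.
  - by move=> i Hi; rewrite (insubT (fun i => i < gn H) Hi) /= valK /= gK.
  - move=> i j Hi Hj; rewrite (insubT (fun i => i < gn G) Hi) (insubT (fun i => i < gn G) Hj) /=.
    by rewrite -He.
exists (fun i : 'I_(gn G) => Ordinal (Hf i (ltn_ord i)).1); split; last by move=> i j; rewrite He.
exists (fun i : 'I_(gn H) => Ordinal (Hg i (ltn_ord i)).1) => i; apply: val_inj => /=.
- by case: (Hf i (ltn_ord i)).
- by case: (Hg i (ltn_ord i)).
Qed.

Lemma pair_graph_iso G H : isomorphic G H -> isomorphic (pair_graph G) (pair_graph H).
Proof.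
move=> /isomorphicP[En [f [g [Hf Hg He]]]]; apply/isomorphicP.
rewrite /iso_maps /= -En in Hf Hg *; split=> //; set n := gn G in Hf Hg He *.
exists (fun p => f (p %/ n) * n + f (p %% n)), (fun p => g (p %/ n) * n + g (p %% n)).
split.
- move=> p Hp; have [H1 E1] := Hf _ (divn_lt Hp); have [H2 E2] := Hf _ (modn_lt Hp).
  by rewrite index_lt // divn_index // modn_index // E1 E2 -divn_eq.
- move=> p Hp; have [H1 E1] := Hg _ (divn_lt Hp); have [H2 E2] := Hg _ (modn_lt Hp).
  by rewrite index_lt // divn_index // modn_index // E1 E2 -divn_eq.
- move=> p q Hp Hq; have [H1 E1] := Hf _ (divn_lt Hp); have [H2 E2] := Hf _ (modn_lt Hp).
  have [H3 E3] := Hf _ (divn_lt Hq); have [H4 E4] := Hf _ (modn_lt Hq).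
  rewrite !pair_graphE -?En ?index_lt // pair_rel_index // /pair_rel /pair_adj -/n.
  (* The lifted map acts on both coordinates by [f]; since [pair_adj] uses coordinates only in
     equality tests and as arguments of [a], injectivity of [f] is what remains. *)
  have inj u v : u < n -> v < n -> (f u == f v) = (u == v).
    move=> Hu Hv; apply/eqP/eqP => [E|-> //].
    by rewrite -(Hf _ Hu).2 E (Hf _ Hv).2.
  by rewrite !inj ?divn_lt ?modn_lt // He ?divn_lt ?modn_lt.
Qed.

Section Recover.
Variables (G H : graph) (f g : nat -> nat).
Hypotheses (En : gn G = gn H) (iso : iso_maps (pair_graph G) (pair_graph H) f g).
Hypotheses (sG : sym_irrefl (gn G) (gedge G)).
Let n := gn G.
Notation diag p := (p %/ n == p %% n).
Notation EG := (pair_rel n (gedge G)).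
Notation EH := (pair_rel n (gedge H)).

Lemma recover_lt p : p < n * n -> f p < n * n.
Proof. by case: iso => /= + _ _ Hp => /(_ _ Hp)[]; rewrite -En. Qed.

Lemma recover_inj p q : p < n * n -> q < n * n -> f p = f q -> p = q.
Proof. by case: iso => /= Hf _ _ Hp Hq E; rewrite -(Hf _ Hp).2 E (Hf _ Hq).2. Qed.

Lemma recover_edge p q : p < n * n -> q < n * n -> EH (f p) (f q) = EG p q.
Proof.
move=> Hp Hq; have [_ _ He] := iso.
by rewrite -pair_graphE // He // pair_graphE -?En ?recover_lt.
Qed.

(* For n >= 3 a vertex (u, u) has three neighbours, all others have at most two. *)
Lemma recover_diag p : 2 < n -> p < n * n -> diag p -> diag (f p).
Proof.
move=> Hn Hp /eqP dp; apply/negPn/negP => nd.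
(* Two further vertices v and w give (u, u) the three neighbours (v, v), (w, w) and (u, v), one more
   than an off-diagonal image could have. *)
have [v [w [Hv Hw nv nw nvw]]] : exists v w,
    [/\ v < n, w < n, v <> p %/ n, w <> p %/ n & v <> w].
  have := divn_lt Hp; move: (p %/ n) => u Hu.
  exists (if u == 0 then 1 else 0), (if u <= 1 then 2 else 1).
  by split; case: (u) Hu => [|[|u']] Hu //=; lia.
set u := p %/ n in dp nv nw.
have Ep : p = u * n + u by rewrite (divn_eq p n) -/u -dp.
have Hu : u < n by exact: divn_lt.
have adj q : q < n * n -> EG p q -> EH (f p) (f q) by move=> Hq; rewrite recover_edge.
have ne u1 v1 u2 v2 : v1 < n -> v2 < n -> u1 * n + v1 = u2 * n + v2 -> u1 = u2 /\ v1 = v2.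
  move=> H1 H2 E; split; first by rewrite -(divn_index u1 H1) E divn_index.
  by rewrite -(modn_index u1 H1) E modn_index.
have A1 : EG p (v * n + v) by rewrite Ep pair_rel_index // /pair_adj; case: ifP; lia.
have A2 : EG p (w * n + w) by rewrite Ep pair_rel_index // /pair_adj; case: ifP; lia.
have A3 : EG p (u * n + v) by rewrite Ep pair_rel_index // /pair_adj; case: ifP; lia.
have I u1 v1 := index_lt (n := n) (u := u1) (v := v1).
case: (nondiag_two_nbrs nd (adj _ (I v v Hv Hv) A1) (adj _ (I w w Hw Hw) A2) (adj _ (I u v Hu Hv) A3));
  move/recover_inj => /(_ ltac:(exact: I) ltac:(exact: I)) /ne => /(_ ltac:(done) ltac:(done)); lia.
Qed.


(** In this case the pair graph is the 4-cycle 0, 1, 2, 3; without the edge it would be the path 1,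
    0, 3, 2, which has vertices of degree one. *)
Lemma pair_two_nbrs p : n = 2 -> gedge G 0 1 -> p < n * n ->
  exists q1 q2, [/\ q1 < n * n, q2 < n * n, q1 <> q2, EG p q1 & EG p q2].
Proof.
move=> n2 a01; have a10 : gedge G 1 0.
  by have [->] := sG (i := 1) (j := 0) ltac:(by rewrite -/n n2) ltac:(by rewrite -/n n2).
rewrite n2.
case: p => [|[|[|[|p]]]] // _.
- by exists 1, 3; split=> //; rewrite /pair_rel /pair_adj.
- by exists 0, 2; split=> //; rewrite /pair_rel /pair_adj.
- by exists 1, 3; split=> //; rewrite /pair_rel /pair_adj.
- by exists 0, 2; split=> //; rewrite /pair_rel /pair_adj.
Qed.

End Recover.

Lemma recover_small G H f g : gn G = gn H -> gn G = 2 ->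
  iso_maps (pair_graph G) (pair_graph H) f g ->
  sym_irrefl (gn G) (gedge G) -> gedge G 0 1 -> gedge H 0 1.
Proof.
move=> En n2 iso sG a01; apply/negPn/negP => h01.
have iso' := iso_maps_sym iso.
have Hp : g 1 < gn G * gn G.
  by have := recover_lt (esym En) iso' (p := 1); rewrite -En n2; apply.
have [q1 [q2 [H1 H2 ne A1 A2]]] := pair_two_nbrs sG n2 a01 Hp.
have [_ Hg _] := iso.
have Eg : f (g 1) = 1 by apply: (Hg 1 _).2; rewrite /= -En n2.
have := recover_edge En iso Hp H1; have := recover_edge En iso Hp H2.
rewrite A1 A2 Eg => B2 B1.
(* Without an edge in [H], vertex 1, which is the pair (0, 1), is pendant at (0, 0); its preimage
   [g 1] has two neighbours. *)
have only q : pair_rel (gn G) (gedge H) 1 q -> q %/ gn G = 0 /\ q %% gn G = 0.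
  rewrite /pair_rel /pair_adj n2 /= -[1 %/ 2]/0 -[1 %% 2]/1 (negPf h01).
  by move: (q %/ 2) (q %% 2) => w z; case: ifP; lia.
have [E1 E1'] := only _ B1; have [E2 E2'] := only _ B2.
apply: ne; apply: (recover_inj iso H1 H2); apply: (@index_inj (gn G)); congruence.
Qed.

(** The clique is mapped to the clique, which defines [r] on the original vertices, and the
    off-diagonal part to the off-diagonal part. An edge uv is the adjacency of (u, v) and (v, u),
    and their images are (r u, r v) and (r v, r u). *)
Lemma recover_edges G H f g : gn G = gn H -> 2 < gn G ->
  iso_maps (pair_graph G) (pair_graph H) f g -> sym_irrefl (gn G) (gedge G) ->
  let n := gn G in let r u := f (u * n + u) %/ n in
  (forall u, u < n -> f (u * n + u) = r u * n + r u) /\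
  (forall u v, u < n -> v < n -> gedge G u v -> gedge H (r u) (r v)).
Proof.
move=> En Hn iso sG n r.
have iso' := iso_maps_sym iso.
have [Hf Hg _] := iso; rewrite /= -En -/n in Hf Hg.
have diagE u : u < n -> f (u * n + u) = r u * n + r u.
  move=> Hu; have I := index_lt Hu Hu.
  have := recover_diag En iso Hn I; rewrite divn_index ?modn_index // eqxx => /(_ isT)/eqP E.
  by rewrite {1}(divn_eq (f (u * n + u)) n) -E.
have nondiag p : p < n * n -> p %/ n != p %% n -> f p %/ n != f p %% n.
  move=> Hp; apply: contraNN => dfp.
  have := recover_diag (esym En) iso'; rewrite -En -/n => /(_ (f p) Hn (Hf p Hp).1 dfp).
  by rewrite (Hf p Hp).2.
split=> // u v Hu Hv auv.
have nuv : u != v by apply: contraTneq auv => ->; case: (sG v v Hv Hv).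
have [Iuv Ivu Iu Iv] : [/\ u * n + v < n * n, v * n + u < n * n, u * n + u < n * n & v * n + v < n * n].
  by split; apply: index_lt.
have ndp := nondiag _ Iuv; rewrite divn_index ?modn_index // in ndp; have {}ndp := ndp nuv.
have ndq := nondiag _ Ivu; rewrite divn_index ?modn_index // eq_sym in ndq; have {}ndq := ndq nuv.
(* The clique neighbour of an off-diagonal vertex is given by its first coordinate, so this
   coordinate is transported by [r]. *)
have row p w : p < n * n -> w < n -> p %/ n = w -> p %% n != w -> f p %/ n != f p %% n -> f p %/ n = r w.
  move=> Hp Hw Epw npw ndfp.
  have A : pair_rel n (gedge H) (f p) (f (w * n + w)).
    rewrite (recover_edge En iso) ?index_lt // /pair_rel Epw divn_index // modn_index // /pair_adj.
    by rewrite (negPf npw) andbF !eqxx.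
  have dw : f (w * n + w) %/ n = f (w * n + w) %% n.
    have := recover_diag En iso Hn (index_lt Hw Hw); rewrite divn_index ?modn_index // eqxx.
    by move=> /(_ isT)/eqP.
  move: (nondiag_nbr ndfp A); rewrite -dw -/(r w) => -[[-> //]|[E1 E2]].
  by case/eqP: ndfp; rewrite -E1 -E2.
have Ep := row _ u Iuv Hu (divn_index _ Hv) ltac:(by rewrite modn_index // eq_sym) ndp.
have Eq := row _ v Ivu Hv (divn_index _ Hu) ltac:(by rewrite modn_index) ndq.
have A : pair_rel n (gedge H) (f (u * n + v)) (f (v * n + u)).
  by rewrite (recover_edge En iso) // pair_rel_index // /pair_adj !eqxx.
have [E1 E2 Hh] := nondiag_nondiag ndp ndq A.
by rewrite -Ep -Eq E1.
Qed.

Lemma pair_graph_iso_inv G H : simple_graph G -> simple_graph H ->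
  isomorphic (pair_graph G) (pair_graph H) -> isomorphic G H.
Proof.
move=> [_ sG] [_ sH] /isomorphicP[/= En2 [f [g iso]]]; apply/isomorphicP.
have En : gn G = gn H by nia.
have iso' := iso_maps_sym iso.
split=> //; set n := gn G in En2 *.
case: (ltnP 2 n) => Hn.
  have [D1 E1] := recover_edges En Hn iso sG.
  have [D2 E2] := recover_edges (esym En) (leq_trans Hn (eq_leq En)) iso' sH.
  rewrite -En -/n in D2 E2; have [Hf Hg _] := iso; rewrite /= -En -/n in Hf Hg.
  pose r u := f (u * n + u) %/ n; pose r' u := g (u * n + u) %/ n.
  have {}D1 u : u < n -> f (u * n + u) = r u * n + r u := D1 u.
  have {}D2 u : u < n -> g (u * n + u) = r' u * n + r' u := D2 u.
  have Hr u : u < n -> r u < n by move=> Hu; apply/divn_lt/(Hf _ _).1/index_lt.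
  have Hr' u : u < n -> r' u < n by move=> Hu; apply/divn_lt/(Hg _ _).1/index_lt.
  have rK u : u < n -> r' (r u) = u.
    by move=> Hu; rewrite /r' -D1 // (Hf _ (index_lt Hu Hu)).2 divn_index.
  have rK' u : u < n -> r (r' u) = u.
    by move=> Hu; rewrite /r -D2 // (Hg _ (index_lt Hu Hu)).2 divn_index.
  exists r, r'; split; rewrite -?En -/n.
  - by move=> i Hi; split; [apply: Hr | apply: rK].
  - by move=> i Hi; split; [apply: Hr' | apply: rK'].
  - move=> i j Hi Hj; apply/idP/idP; first exact: E1.
    by move=> h; have := E2 _ _ (Hr i Hi) (Hr j Hj) h; rewrite -/(r' _) -/(r' _) !rK.
(* With at most two vertices the only possible edge is 01, so the identity is an isomorphism once
   both graphs agree on it. *)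
have s01 : n = 2 -> gedge G 0 1 = gedge H 0 1.
  move=> n2; apply/idP/idP.
    exact: recover_small iso sG.
  by apply: recover_small iso' sH; rewrite -?En.
exists id, id; split; rewrite -?En -/n // => i j Hi Hj.
have lG k : k < n -> gedge G k k = false by move=> Hk; exact/negbTE/(sG k k Hk Hk).2.
have lH k : k < n -> gedge H k k = false.
  by rewrite /n En => Hk; exact/negbTE/(sH k k Hk Hk).2.
case: (ltngtP i j) => Hij; last by rewrite Hij lG ?lH.
- have [-> -> n2] : [/\ i = 0, j = 1 & n = 2] by split; lia.
  exact: s01.
- have [Ei Ej n2] : [/\ i = 1, j = 0 & n = 2] by split; lia.
  have [-> _] := sG _ _ Hi Hj; rewrite /n En in Hi Hj; have [-> _] := sH _ _ Hi Hj.
  by rewrite Ei Ej s01.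
Qed.

(** * Program logic *)

Section ProgramLogic.
Variable V : finType.
Notation pstate := (pstate V).
Notation cmd := (cmd V).

(** The first premise asks that the invariant ignore [h], because [run] reassigns [h] before each
    round and after the last. Variables that the loop does not write may be used at their initial
    values. *)
Lemma run_For (x : seq bool) (h : V) (c : cmd) (s : pstate) (I : nat -> pstate -> Prop) :
  (forall t v s', I t s' -> I t (set_var h v s')) -> I 0 s ->
  (forall t (s' : pstate), t <= size x -> s'.1 h = t ->
     (forall i, i \notin h :: writes c -> s'.1 i = s.1 i) ->
     I t s' -> I t.+1 (run x c s')) ->
  I (size x).+1 (run x (For h c) s).
Proof.
move=> stable I0 step; apply: (stable).
set f := fun s t => run x c (set_var h t s).
suff main k : k <= (size x).+1 -> I k (foldl f s (iota 0 k)) /\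
    forall i, i \notin h :: writes c -> (foldl f s (iota 0 k)).1 i = s.1 i.
  by have [] := main _ (leqnn _).
elim: k => [|k IH] Hk //.
have [Ik fr] := IH (ltnW Hk).
have fr' i : i \notin h :: writes c ->
    (set_var h k (foldl f s (iota 0 k))).1 i = s.1 i.
  by move=> Hi; rewrite -fr // /= updE; move: Hi; rewrite inE negb_or => /andP[/negPf->].
rewrite -addn1 iotaD foldl_cat add0n addn1 /= {1 3}/f; split.
  by apply: step => //; [rewrite /= updE eqxx | exact: stable].
by move=> i Hi; rewrite run_frame ?fr' //; move: Hi; rewrite inE negb_or => /andP[].
Qed.

Definition var_lt (i j : V) (o : obs V) := obs_le i j o && ~~ obs_le j i o.
Definition var_eq (i j : V) (o : obs V) := obs_le i j o && obs_le j i o.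

Lemma var_ltE x e i j : var_lt i j (observe x e) = (e i <= size x) && (e i < e j).
Proof. by rewrite /var_lt !obs_leE; lia. Qed.

Lemma var_eqE x e i j : var_eq i j (observe x e) = (e i <= size x) && (e i == e j).
Proof. by rewrite /var_eq !obs_leE; lia. Qed.

(** All loops run over the input positions, so counting up to a pointer [n] is a full loop with a
    guarded body. *)
Definition ForLt (h n : V) (c : cmd) := For h (If (var_lt h n) c (Skip V)).

Lemma writes_ForLt h n c : writes (ForLt h n c) = h :: writes c.
Proof. by rewrite /= cats0. Qed.

Lemma run_ForLt (x : seq bool) (h n : V) (c : cmd) (s : pstate) (I : nat -> pstate -> Prop) :
  n \notin h :: writes c -> s.1 n <= (size x).+1 ->
  (forall t v s', I t s' -> I t (set_var h v s')) -> I 0 s ->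
  (forall t (s' : pstate), t < s.1 n -> s'.1 h = t ->
     (forall i, i \notin h :: writes c -> s'.1 i = s.1 i) ->
     I t s' -> I t.+1 (run x c s')) ->
  I (s.1 n) (run x (ForLt h n c) s).
Proof.
move=> Hn Hle stable I0 step; rewrite -{1}(minn_idPr Hle).
(* Rounds from [s.1 n] on change only [h], so the count is cut off there. *)
apply: (@run_For x h _ s (fun t => I (minn t (s.1 n)))).
- by move=> t v s'; exact: stable.
- by rewrite min0n.
- move=> t s' Ht Eh fr It; rewrite /= cats0 in fr.
  rewrite /= var_ltE Eh Ht (fr _ Hn) /=.
  case: ltnP => Hlt; last by rewrite (minn_idPr (leqW Hlt)); rewrite (minn_idPr Hlt) in It.
  rewrite (minn_idPl Hlt); apply: step => //; by rewrite (minn_idPl (ltnW Hlt)) in It.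
Qed.

Lemma run_ForLt_out x h n c (s : pstate) (F : nat -> seq bool) :
  n \notin h :: writes c -> s.1 n <= (size x).+1 ->
  (forall t (s' : pstate), t < s.1 n -> s'.1 h = t ->
     (forall i, i \notin h :: writes c -> s'.1 i = s.1 i) ->
     (run x c s').2 = s'.2 ++ F t) ->
  (run x (ForLt h n c) s).2 = s.2 ++ flatten [seq F t | t <- iota 0 (s.1 n)].
Proof.
move=> Hn Hle step.
apply: (@run_ForLt x h n c s (fun t s' => s'.2 = s.2 ++ flatten [seq F t | t <- iota 0 t])) => //.
  by rewrite cats0.
move=> t s' Ht Eh fr It; rewrite (step _ _ Ht Eh fr) It.
by rewrite -addn1 iotaD add0n map_cat flatten_cat /= cats0 catA.
Qed.

(** * Arithmetic on pointers and scanning of unary numbers *)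

Definition Inc (i : V) : cmd := Act (Move i i true).
Definition Assign (i j : V) : cmd := Act (Move i j false).

Lemma run_Assign x i j (s : pstate) : (run x (Assign i j) s).1 i = s.1 j.
Proof. by rewrite /= updE eqxx addn0. Qed.

Definition AddVar (q b g : V) := ForLt g b (Inc q).
Definition AddMul (q a b h g : V) := ForLt h a (AddVar q b g).
Definition Locate (q base u n v h g : V) :=
  Seq (Assign q base) (Seq (AddMul q u n h g) (AddVar q v g)).

Lemma run_AddVar x q b g (s : pstate) : uniq [:: q; g; b] -> s.1 b <= (size x).+1 ->
  (run x (AddVar q b g) s).1 q = s.1 q + s.1 b.
Proof.
rewrite /= !inE negb_or andbT => /andP[/andP[qg qb] gb] Hb.
apply: (@run_ForLt x g b (Inc q) s (fun t s' => s'.1 q = s.1 q + t)) => //.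
- by rewrite !inE negb_or eq_sym gb eq_sym qb.
- by move=> t v s' <-; rewrite /= updE (negPf qg).
- by rewrite addn0.
- by move=> t s' _ _ _ /= E; rewrite updE eqxx E addn1 addnS.
Qed.

Lemma run_AddMul x q a b h g (s : pstate) : uniq [:: q; h; g; a] -> uniq [:: q; h; g; b] ->
  s.1 a <= (size x).+1 -> s.1 b <= (size x).+1 ->
  (run x (AddMul q a b h g) s).1 q = s.1 q + s.1 a * s.1 b.
Proof.
rewrite [uniq _]/= [uniq _]/= !inE !negb_or !andbT => /and3P[/and3P[qh qg qa] /andP[hg ha] ga].
move=> /and3P[/and3P[_ _ qb] /andP[_ hb] gb] Ha Hb.
apply: (@run_ForLt x h a _ s (fun t s' => s'.1 q = s.1 q + t * s.1 b)) => //.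
- by rewrite !inE !negb_or eq_sym ha eq_sym ga eq_sym qa.
- by move=> t v s' <-; rewrite /= updE (negPf qh).
- by rewrite addn0.
- move=> t s' _ _ fr E; have Eb : s'.1 b = s.1 b.
    by apply: fr; rewrite !inE !negb_or eq_sym hb eq_sym gb eq_sym qb.
  rewrite run_AddVar ?Eb //; first by rewrite E mulSn addnAC addnA.
  by rewrite /= !inE !negb_or qg qb gb.
Qed.

Lemma run_Locate x q base u n v h g (s : pstate) :
  uniq [:: q; h; g; u] -> uniq [:: q; h; g; v] -> uniq [:: q; h; g; n] ->
  s.1 u <= (size x).+1 -> s.1 v <= (size x).+1 -> s.1 n <= (size x).+1 ->
  (run x (Locate q base u n v h g) s).1 q = s.1 base + s.1 u * s.1 n + s.1 v.
Proof.
move=> Du Dv Dn Hu Hv Hn; pose s1 := run x (Assign q base) s.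
rewrite -[run _ _ _]/(run x (AddVar q v g) (run x (AddMul q u n h g) s1)).
have ne i : uniq [:: q; h; g; i] -> (i == q) = false.
  by rewrite /= !inE !negb_or => /and3P[/and3P[_ _ /negPf]]; rewrite eq_sym.
have E1 i : uniq [:: q; h; g; i] -> s1.1 i = s.1 i by move=> D; rewrite /= updE ne.
have E2 : (run x (AddMul q u n h g) s1).1 v = s.1 v.
  rewrite run_frame ?E1 // /AddMul /AddVar !writes_ForLt.
  move: Dv; rewrite /= !inE !negb_or => /and4P[/and3P[_ _ a] /andP[_ b] c _].
  by rewrite (eq_sym v h) b (eq_sym v g) c (eq_sym v q) a.
rewrite run_AddVar ?E2 //; last first.
  by move: Dv; rewrite /= !inE !negb_or !andbT => /and3P[/and3P[_ -> ->] _ ->].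
by rewrite run_AddMul ?(E1 u) ?(E1 n) // /s1 /= updE eqxx addn0.
Qed.

(** This is a while loop in the guise of a bounded one: once [h] reaches [p], both advance together
    along the ones; at the first zero [p] stays behind and is never met again. *)
Definition CountOnes (p c h : V) :=
  For h (If (fun o => var_eq h p o && obs_bit p o) (Seq (Inc p) (Inc c)) (Skip V)).

Lemma find_nth_ones (y : seq bool) i : i <= find negb y -> nth false y i = (i < find negb y).
Proof.
move=> Hi; case: ltnP => Hlt; first by have := before_find false Hlt => /negbFE.
have -> : i = find negb y by lia.
case: (boolP (has negb y)) => [/(nth_find false)/negbTE // | /hasNfind ->].
by rewrite nth_default.
Qed.

Lemma run_CountOnes x p c h (s : pstate) : uniq [:: p; c; h] ->
  let k := find negb (drop (s.1 p) x) in let s' := run x (CountOnes p c h) s in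
  s'.1 p = s.1 p + k /\ s'.1 c = s.1 c + k.
Proof.
rewrite /= !inE negb_or andbT => /andP[/andP[pc ph] ch].
set k := find _ _; set p0 := s.1 p; set c0 := s.1 c.
have Hk : k <= size x - p0 by rewrite /k -size_drop find_size.
(* The truncated difference [t - p0] covers the rounds before [h] reaches [p0], the minimum with [k]
   those after the first zero. *)
pose I t (s' : pstate) := s'.1 p = p0 + minn k (t - p0) /\ s'.1 c = c0 + minn k (t - p0).
have : I (size x).+1 (run x (CountOnes p c h) s).
  apply: run_For.
  - by move=> t v s' [E1 E2]; rewrite /I /= !updE (negPf ph) (negPf ch).
  - by rewrite /I sub0n minn0 !addn0.
  move=> t s' Ht Eh _ [E1 E2]; rewrite /= var_eqE obs_bitE Eh Ht E1 /=.
  have -> : (t == p0 + minn k (t - p0)) && nth false x (p0 + minn k (t - p0)) =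
            (p0 <= t) && (t - p0 < k).
    case: eqP => [Et|ne]; last by lia.
    have [Hp Hk'] : p0 <= t /\ t - p0 <= k by lia.
    by rewrite -Et Hp -(find_nth_ones Hk') nth_drop subnKC.
  case: ifP => Hc; rewrite /I /=.
    by rewrite !updE !eqxx (eq_sym c) (negPf pc) ?E1 E2; lia.
  by rewrite E1 E2; lia.
by rewrite /I (_ : minn k _ = k) //; lia.
Qed.

Definition SetEnd (l h : V) := For h (Assign l h).

Lemma run_SetEnd x l h (s : pstate) : l != h -> (run x (SetEnd l h) s).1 l = size x.
Proof.
move=> lh; pose I t (s' : pstate) := 0 < t -> s'.1 l = t.-1.
have : I (size x).+1 (run x (SetEnd l h) s).
  apply: run_For => //; first by move=> t v s' E Ht; rewrite /= updE (negPf lh) E.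
  by move=> t s' _ Eh _ _ _; rewrite /= updE eqxx Eh addn0.
exact.
Qed.

End ProgramLogic.

(** * Decoding graphs *)

Definition decode_at (x : seq bool) (b n : nat) : graph :=
  Graph n (take (n * n) (drop b x)).

Lemma gedge_decode_at x b n u v : u < n -> v < n ->
  gedge (decode_at x b n) u v = nth false x (b + u * n + v).
Proof.
by move=> Hu Hv; rewrite /gedge /= nth_take ?nth_drop ?addnA //; nia.
Qed.

Lemma find_ones n (y : seq bool) : find negb (nseq n true ++ false :: y) = n.
Proof. by elim: n => //= n ->. Qed.

Lemma enc_graph_cat G y : enc_graph G ++ y = nseq (gn G) true ++ false :: gadj G ++ y.
Proof. by rewrite /enc_graph /enc_nat -!catA. Qed.

Lemma drop_enc_graph G y : size (gadj G) = gn G * gn G ->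
  drop (gn G + 1 + gn G * gn G) (enc_graph G ++ y) = y.
Proof.
move=> E; rewrite -E drop_size_cat // /enc_graph /enc_nat !size_cat size_nseq /=; lia.
Qed.

Lemma decode_enc_graph z G y : size (gadj G) = gn G * gn G ->
  decode_at (z ++ enc_graph G ++ y) (size z + (gn G + 1)) (gn G) = G.
Proof.
case: G => n a /= E; rewrite /decode_at; congr Graph.
rewrite /enc_graph /= -catA catA drop_size_cat -?E ?take_size_cat //.
by rewrite size_cat /enc_nat size_cat size_nseq.
Qed.

Lemma enc_graph_decode x : let n := find negb x in n + 1 + n * n <= size x ->
  x = enc_graph (decode_at x (n + 1) n) ++ drop (n + 1 + n * n) x.
Proof.
move=> n Hn; rewrite enc_graph_cat /=.
have Hlt : n < size x by lia.
rewrite (addnC (n + 1)) -[drop (n * n + _) x]drop_drop cat_take_drop addn1.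
rewrite -[in LHS](cat_take_drop n x) (drop_nth false) //.
congr (_ ++ _ :: _).
  apply: (@eq_from_nth _ false); rewrite ?size_nseq size_takel //; try lia.
  by move=> i Hi; rewrite nth_take // nth_nseq Hi find_nth_ones //; lia.
by rewrite find_nth_ones ?ltnn.
Qed.

(** The encoding is self-delimiting: the unary header fixes how many bits belong to the matrix. *)
Lemma enc_graph_inj G G' y y' : size (gadj G) = gn G * gn G ->
  size (gadj G') = gn G' * gn G' ->
  enc_graph G ++ y = enc_graph G' ++ y' -> G = G' /\ y = y'.
Proof.
move=> sG sG' E; have En : gn G = gn G'.
  by have := congr1 (find negb) E; rewrite !enc_graph_cat !find_ones.
split.
  by rewrite -(decode_enc_graph [::] y sG) E En (decode_enc_graph [::] y' sG').
by rewrite -(drop_enc_graph y sG) E En drop_enc_graph.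
Qed.

Lemma enc_pair_neq_nil G H : enc_pair G H <> [::].
Proof. by rewrite /enc_pair enc_graph_cat; case: (gn G). Qed.

Lemma flatten_mkseq T m n (F : nat -> nat -> T) :
  flatten [seq [seq F u v | v <- iota 0 n] | u <- iota 0 m] =
  mkseq (fun i => F (i %/ n) (i %% n)) (m * n).
Proof.
elim: m => [|m IH]; first by rewrite mul0n.
rewrite -addn1 iotaD map_cat flatten_cat IH /mkseq mulnDl mul1n iotaD map_cat; congr (_ ++ _).
rewrite /= cats0 !add0n -[m * n in RHS]addn0 iotaDl -map_comp; apply/eq_in_map => v.
by rewrite mem_iota add0n => Hv /=; rewrite divn_index ?modn_index.
Qed.

Lemma flatten_map_flatten (S T : Type) (f : S -> seq (seq T)) s :
  flatten [seq flatten (f u) | u <- s] = flatten (flatten (map f s)).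
Proof. by elim: s => //= u s ->; rewrite flatten_cat. Qed.

Lemma flatten_map_seq1 (S T : Type) (f : S -> T) s : flatten [seq [:: f u] | u <- s] = map f s.
Proof. by elim: s => //= u s ->. Qed.

Lemma flatten_const T (a : T) n :
  flatten [seq flatten [seq [:: a] | _ <- iota 0 n] | _ <- iota 0 n] = nseq (n * n) a.
Proof.
under eq_map => u do rewrite flatten_map_seq1.
rewrite (flatten_mkseq n n (fun _ _ => a)).
by apply: (@eq_from_nth _ a) => [|i]; rewrite size_mkseq ?size_nseq // => Hi; rewrite nth_mkseq ?nth_nseq ?Hi.
Qed.

(** Four nested loops run through (u, v), (w, z) lexicographically, which is the row-major order of
    the matrix of the pair graph. *)
Lemma gadj_pair_graph G :
  let n := gn G in
  flatten [seq flatten [seq flatten [seq flatten [seq [:: pair_adj (gedge G) u v w z]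
    | z <- iota 0 n] | w <- iota 0 n] | v <- iota 0 n] | u <- iota 0 n] =
  gadj (pair_graph G).
Proof.
move=> n.
under eq_map => u do under eq_map => v do (under eq_map => w do rewrite flatten_map_seq1;
  rewrite (flatten_mkseq n n (pair_adj (gedge G) u v))).
by rewrite flatten_map_flatten (flatten_mkseq n n) /mkseq flatten_mkseq.
Qed.

(** * The reduction from Graph Isomorphism *)

Notation vr k := (@Ordinal 20 k isT).

(* [vN1], [vN2] hold the numbers of vertices of the two graphs, [vB1], [vB2] the positions where
   their adjacency matrices start, [vE] the end of the second matrix and [vL] the input length. *)
Definition vN1 := vr 0.
Definition vB1 := vr 1.
Definition vN2 := vr 2.
Definition vB2 := vr 3.
Definition vE := vr 4.
Definition vL := vr 5.
Definition vH := vr 6.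
Definition vG := vr 7.
Definition vP := vr 8.
Definition vU := vr 9.
Definition vT := vr 10.
Definition vW := vr 11.
Definition vZ := vr 12.

Definition OutIf (b : obs 'I_20 -> bool) :=
  If b (Act (Out _ true)) (Act (Out _ false)).

Lemma run_OutIf x b s : (run x (OutIf b) s).2 = s.2 ++ [:: b (observe x s.1)].
Proof. by rewrite /=; case: (b _); rewrite /= cats1. Qed.

Definition pair_test (o : obs 'I_20) :=
  if var_eq vU vZ o && var_eq vT vW o then obs_bit vP o
  else var_eq vW vZ o && (var_eq vU vW o || var_eq vU vT o) ||
       var_eq vU vT o && var_eq vU vW o.

Definition EmitOnes (n : 'I_20) := ForLt vU n (ForLt vT n (Act (Out _ true))).

Definition EmitRow (n : 'I_20) := ForLt vW n (ForLt vZ n (OutIf pair_test)).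

Definition EmitRows (n b : 'I_20) :=
  ForLt vU n (ForLt vT n (Seq (Locate vP b vU n vT vH vG) (EmitRow n))).

Definition EmitPairGraph (n b : 'I_20) :=
  Seq (EmitOnes n) (Seq (Act (Out _ false)) (EmitRows n b)).

Ltac distinct := by rewrite /= ?inE -?val_eqE /= ?val_eqE; lia.

Lemma run_EmitRow x (n : 'I_20) (s : pstate 'I_20) :
  n < 6 -> s.1 n <= size x -> s.1 vU < s.1 n -> s.1 vT < s.1 n ->
  (run x (EmitRow n) s).2 = s.2 ++
  flatten [seq flatten [seq [:: pair_adj (fun _ _ => nth false x (s.1 vP)) (s.1 vU) (s.1 vT) w z]
    | z <- iota 0 (s.1 n)] | w <- iota 0 (s.1 n)].
Proof.
move=> Hn Hle HU HT; apply: run_ForLt_out => [||t s1 Ht Ew fr1]; [distinct|exact: leqW|].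
have En : s1.1 n = s.1 n by apply: fr1; distinct.
rewrite -En; apply: run_ForLt_out => [||t' s2]; [distinct|rewrite En; exact: leqW|].
rewrite En => Ht' Ez fr2.
have E i : i \in [:: vP; vU; vT] -> s2.1 i = s.1 i.
  by move=> Hi; rewrite fr2 ?fr1 //; move: Hi; rewrite !inE => /or3P[] /eqP->.
have EW : s2.1 vW = t by rewrite fr2.
rewrite run_OutIf /pair_test !var_eqE obs_bitE Ez EW !E //.
have le k : k < s.1 n -> k <= size x by move=> Hk; exact: leq_trans (ltnW Hk) Hle.
by rewrite !le.
Qed.

(** The parsed data sit in registers below 6, and emission writes only registers from 6 on; this is
    the purpose of the bounds on [n] and [b]. *)
Lemma run_EmitPairGraph x (n b : 'I_20) (s : pstate 'I_20) :
  n < 6 -> b < 6 -> s.1 n <= size x ->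
  (run x (EmitPairGraph n b) s).2 =
  s.2 ++ enc_graph (pair_graph (decode_at x (s.1 b) (s.1 n))).
Proof.
move=> Hn Hb Hle; set G := decode_at _ _ _.
have ones : (run x (EmitOnes n) s).2 = s.2 ++ nseq (s.1 n * s.1 n) true.
  rewrite -flatten_const; apply: run_ForLt_out => [||t s1 Ht Eu fr1]; [distinct|exact: leqW|].
  have En : s1.1 n = s.1 n by apply: fr1; distinct.
  rewrite -En; apply: run_ForLt_out => [||t' s2 _ _ _]; [distinct|rewrite En; exact: leqW|].
  by rewrite /= cats1.
set s0 := run x (Act (Out _ false)) (run x (EmitOnes n) s).
have E0 (i : 'I_20) : i < 6 -> s0.1 i = s.1 i.
  by move=> Hi; rewrite /s0 !run_frame // /EmitOnes !writes_ForLt; distinct.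
have rows : (run x (EmitRows n b) s0).2 = s0.2 ++ gadj (pair_graph G).
  rewrite -gadj_pair_graph [gn G]/= -(E0 n Hn).
  apply: run_ForLt_out => [||u s1]; [distinct|rewrite E0 //; exact: leqW|].
  rewrite E0 // => Hu Eu fr1.
  have E1 (i : 'I_20) : i < 6 -> s1.1 i = s.1 i by move=> Hi; rewrite fr1 ?E0 //; distinct.
  rewrite -(E1 n) //; apply: run_ForLt_out => [||v s2]; [distinct|rewrite E1 //; exact: leqW|].
  rewrite E1 // => Hv Ev fr2.
  have E2 (i : 'I_20) : i < 6 -> s2.1 i = s.1 i by move=> Hi; rewrite fr2 ?E1 //; distinct.
  have E2u : s2.1 vU = u by rewrite fr2.
  set s3 := run x (Locate vP b vU n vT vH vG) s2.
  have E3 (i : 'I_20) : i < 6 -> s3.1 i = s.1 i.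
    move=> Hi; rewrite /s3 run_frame ?E2 // /Locate /AddMul /AddVar /=.
    by rewrite !inE -!val_eqE /=; lia.
  have E3u : s3.1 vU = u by rewrite /s3 run_frame.
  have E3v : s3.1 vT = v by rewrite /s3 run_frame.
  have EP : s3.1 vP = s.1 b + u * s.1 n + v.
    have le k : k < s.1 n -> k <= (size x).+1.
      by move=> Hk; exact: leqW (leq_trans (ltnW Hk) Hle).
    have Hle' := leqW Hle.
    by rewrite /s3 run_Locate ?E2u ?Ev ?(E2 n) ?(E2 b) ?(le u) ?(le v) //; distinct.
  rewrite -[run x _ s2]/(run x (EmitRow n) s3) run_EmitRow ?(E3 n) ?E3u ?E3v //.
  have -> : s3.2 = s2.2 by rewrite /s3 run_silent.
  congr (_ ++ flatten _); apply/eq_in_map => w; rewrite mem_iota add0n => Hw.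
  congr flatten; apply/eq_in_map => z; rewrite mem_iota add0n => Hz.
  by rewrite /pair_adj EP gedge_decode_at.
rewrite -[run x _ s]/(run x (EmitRows n b) s0) rows.
rewrite (_ : s0.2 = rcons (run x (EmitOnes n) s).2 false) // ones.
by rewrite -cats1 /enc_graph /enc_nat /= -!catA.
Qed.

Definition Header (p c : 'I_20) := Seq (CountOnes p c vH) (Inc p).

Definition Parse : cmd 'I_20 :=
  Seq (Header vB1 vN1)
 (Seq (Assign vB2 vB1)
 (Seq (AddMul vB2 vN1 vN1 vH vG)
 (Seq (Header vB2 vN2)
 (Seq (Assign vE vB2)
 (Seq (AddMul vE vN2 vN2 vH vG)
      (SetEnd vL vH)))))).

Definition Reduction : cmd 'I_20 :=
  Seq Parse
      (If (var_eq vE vL) (Seq (EmitPairGraph vN1 vB1) (EmitPairGraph vN2 vB2)) (Skip _)).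

Lemma run_Header x p c (s : pstate 'I_20) : uniq [:: p; c; vH] ->
  let k := find negb (drop (s.1 p) x) in let s' := run x (Header p c) s in
  s'.1 p = s.1 p + (k + 1) /\ s'.1 c = s.1 c + k.
Proof.
move=> D k s'; have [] := run_CountOnes x s D.
rewrite /s' -[run x (Header p c) s]/(do_act (Move p p true) (run x (CountOnes p c vH) s)).
move: (run x (CountOnes p c vH) s) => s1 E1 E2.
move: D; rewrite /= !inE negb_or => /andP[/andP[/negPf pc _] _].
by rewrite !updE eqxx (eq_sym c) pc E1 E2 -addnA.
Qed.

(** On a malformed input the computed positions may exceed [size x]; they stay exact in the
    semantics. Only the loop bounds [n] and [m] have to lie within the input, as the length of a run
    of ones does. *)
Lemma run_Parse x : let n := find negb x in let b := n + 1 + n * n in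
  let m := find negb (drop b x) in
  let s := run x Parse (env0 _, [::]) in
  [/\ s.2 = [::], (s.1 vN1 = n) * (s.1 vB1 = n + 1), (s.1 vN2 = m) * (s.1 vB2 = b + (m + 1)),
      s.1 vE = b + (m + 1) + m * m & s.1 vL = size x].
Proof.
move=> n b m s.
have Hn : n <= size x by exact: find_size.
have Hm : m <= size x by rewrite (leq_trans (find_size _ _)) // size_drop leq_subr.
pose s0 : pstate 'I_20 := (env0 _, [::]); have z0 i : s0.1 i = 0 by rewrite /= ffunE.
pose s1 := run x (Header vB1 vN1) s0.
pose s2 := run x (Assign vB2 vB1) s1.
pose s3 := run x (AddMul vB2 vN1 vN1 vH vG) s2.
pose s4 := run x (Header vB2 vN2) s3.
pose s5 := run x (Assign vE vB2) s4.
pose s6 := run x (AddMul vE vN2 vN2 vH vG) s5.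
have Es : s = run x (SetEnd vL vH) s6 by [].
have O : s.2 = [::] by exact: run_silent.
clearbody s; subst s.
have [] := run_Header x (p := vB1) (c := vN1) s0 isT; rewrite -/s1 !z0 drop0 !add0n -/n => B1 N1.
have fr1 : s1.1 vN2 = 0 by rewrite /s1 run_frame.
clearbody s1.
have B2 : s2.1 vB2 = n + 1 by rewrite run_Assign.
have fr2 i : i != vB2 -> s2.1 i = s1.1 i by move=> Hi; rewrite /s2 run_frame // inE.
clearbody s2.
have B3 : s3.1 vB2 = b by rewrite /s3 run_AddMul // ?(fr2 vN1) // N1 ?B2 ?leqW.
have fr3 i : i \notin [:: vH; vG; vB2] -> s3.1 i = s2.1 i by move=> Hi; rewrite /s3 run_frame.
clearbody s3.
have [] := run_Header x (p := vB2) (c := vN2) s3 isT; rewrite -/s4 B3 (fr3 vN2) // (fr2 vN2) // fr1 add0n -/m => B4 N4.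
have fr4 i : i \notin [:: vH; vB2; vN2; vB2] -> s4.1 i = s3.1 i by move=> Hi; rewrite /s4 run_frame.
clearbody s4.
have E5 : s5.1 vE = b + (m + 1) by rewrite run_Assign.
have fr5 i : i != vE -> s5.1 i = s4.1 i by move=> Hi; rewrite /s5 run_frame // inE.
clearbody s5.
have E6 : s6.1 vE = b + (m + 1) + m * m by rewrite /s6 run_AddMul // ?(fr5 vN2) // N4 ?E5 ?leqW.
have fr6 i : i \notin [:: vH; vG; vE] -> s6.1 i = s5.1 i by move=> Hi; rewrite /s6 run_frame.
clearbody s6.
have fr7 i : i \notin [:: vH; vL] -> (run x (SetEnd vL vH) s6).1 i = s6.1 i by move=> Hi; rewrite run_frame.
split=> //.
- by rewrite !fr7 // !fr6 // !fr5 // !fr4 // !fr3 // !fr2.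
- by rewrite !fr7 // !fr6 // !fr5.
- by rewrite fr7.
- by rewrite run_SetEnd.
Qed.

Definition reduce (x : seq bool) := (run x Reduction (env0 _, [::])).2.

Lemma reduceE x : let n := find negb x in let b := n + 1 + n * n in
  let m := find negb (drop b x) in
  reduce x = if b + (m + 1) + m * m == size x
             then enc_pair (pair_graph (decode_at x (n + 1) n))
                           (pair_graph (decode_at x (b + (m + 1)) m))
             else [::].
Proof.
move=> n b m; have [] := run_Parse x; rewrite -/n -/b -/m.
rewrite /reduce /Reduction run_Seq run_If.
set s := run x Parse _ => O [N1 B1] [N2 B2] E L.
rewrite var_eqE E L; case: eqP => [Ee|]; last by rewrite andbF.
rewrite Ee leqnn andTb run_Seq; set s' := run x (EmitPairGraph vN1 vB1) s.
have EN : s'.1 vN2 = m by rewrite /s' run_frame.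
have EB : s'.1 vB2 = b + (m + 1) by rewrite /s' run_frame.
rewrite run_EmitPairGraph ?EN ?EB //; last by lia.
by rewrite /s' run_EmitPairGraph ?N1 ?B1 ?O //; lia.
Qed.

Lemma reduce_enc_pair G H : size (gadj G) = gn G * gn G -> size (gadj H) = gn H * gn H ->
  reduce (enc_pair G H) = enc_pair (pair_graph G) (pair_graph H).
Proof.
move=> sG sH; rewrite reduceE.
have En : find negb (enc_pair G H) = gn G by rewrite /enc_pair enc_graph_cat find_ones.
have Em : find negb (enc_graph H) = gn H by rewrite -[enc_graph H]cats0 enc_graph_cat find_ones.
rewrite En /enc_pair drop_enc_graph // Em.
have sE K : size (gadj K) = gn K * gn K -> size (enc_graph K) = gn K + 1 + gn K * gn K.
  by move=> sK; rewrite /enc_graph /enc_nat !size_cat size_nseq sK.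
rewrite size_cat !sE // -!addnA eqxx !addnA.
congr (enc_graph (pair_graph _) ++ enc_graph (pair_graph _)).
- exact: (decode_enc_graph [::]).
- by rewrite -sE // -[enc_graph H]cats0 -addnA decode_enc_graph.
Qed.

(** The length is all that the reduction checks, so [G] and [H] have matrices of the right size but
    may fail to be simple. *)
Lemma reduce_neq_nil x : reduce x <> [::] -> exists G H,
  [/\ size (gadj G) = gn G * gn G, size (gadj H) = gn H * gn H & x = enc_pair G H].
Proof.
rewrite reduceE; set n := find negb x; set b := n + 1 + n * n; set m := find negb _.
case: eqP => // Ee _.
exists (decode_at x (n + 1) n), (decode_at (drop b x) (m + 1) m).
have sb : size (drop b x) = m + 1 + m * m by rewrite size_drop; lia.
split.
- by rewrite /= size_takel // size_drop; lia.
- by rewrite /= size_takel // size_drop sb; lia.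
- rewrite [LHS]enc_graph_decode -/n -/b; last by lia.
  rewrite [in LHS](@enc_graph_decode (drop b x)) -/m; last by lia.
  by rewrite [drop _ (drop b x)]drop_oversize ?sb // cats0.
Qed.

Lemma GI_reduces : poly_reduces GI (GI_on diamond_2P3_free).
Proof.
exists reduce; split; first exact: loop_poly_computable.
move=> x; split.
- move=> [G [H [[sG sH _ _] [-> iso]]]].
  exists (pair_graph G), (pair_graph H); split; last first.
    by rewrite reduce_enc_pair ?sG.1 ?sH.1 //; split=> //; exact: pair_graph_iso.
  by split; try exact: pair_graph_free; apply/pair_graph_simple; [exact: sG.2 | exact: sH.2].
- move=> [G' [H' [[sG' sH' _ _] [E iso]]]].
  have [|G [H [sG sH Ex]]] := @reduce_neq_nil x; first by rewrite E; exact: enc_pair_neq_nil.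
  rewrite Ex reduce_enc_pair // /enc_pair in E.
  have sP K : size (gadj (pair_graph K)) = gn (pair_graph K) * gn (pair_graph K).
    by rewrite size_mkseq.
  have [EG EH] := enc_graph_inj (sP G) sG'.1 E.
  have [EH' _] : pair_graph H = H' /\ [::] = [::] :> seq bool.
    by apply: enc_graph_inj (sP H) sH'.1 _; rewrite !cats0.
  subst G' H'; exists G, H.
  (* Simplicity of [G] and [H], never tested by the program, is inherited from their pair graphs. *)
  have iG : simple_graph G by split=> //; exact/pair_graph_simple.
  have iH : simple_graph H by split=> //; exact/pair_graph_simple.
  by split=> //; split=> //; exact: pair_graph_iso_inv.
Qed.

(** * Searching for an induced subgraph *)

(* These reuse [vN2], [vB2] and [vE], which the search leaves free. *)
Definition vFound := vr 2.
Definition vBad := vr 3.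
Definition vZero := vr 4.

Section FindPattern.
Variables (pat : graph) (vs : seq 'I_20).
Hypotheses (vs_uniq : uniq vs) (vs_ge : all (fun i : 'I_20 => 10 <= i) vs)
  (vs_size : size vs = gn pat).

Definition pv (i : nat) : 'I_20 := nth vZero vs i.

Definition match_test (ij : nat * nat) (o : obs 'I_20) :=
  (obs_bit vP o == gedge pat ij.1 ij.2) &&
  (var_eq (pv ij.1) (pv ij.2) o == (ij.1 == ij.2)).

Definition CheckPair (ij : nat * nat) : cmd 'I_20 :=
  Seq (Locate vP vB1 (pv ij.1) vN1 (pv ij.2) vH vG)
      (If (match_test ij) (Skip _) (Inc vBad)).

Definition CheckPairs (l : seq (nat * nat)) := foldr (fun ij => Seq (CheckPair ij)) (Skip _) l.

Definition index_pairs :=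
  [seq (i, j) | i <- iota 0 (gn pat), j <- iota 0 (gn pat)].

Lemma mem_index_pairs i j : ((i, j) \in index_pairs) = (i < gn pat) && (j < gn pat).
Proof.
apply/allpairsP/andP => [[[i' j'] [+ + [-> ->]]]|[Hi Hj]]; rewrite ?mem_iota //.
by exists (i, j); rewrite !mem_iota.
Qed.

(** Pointers are the only memory, so a flag is a counter that is compared with zero; it may grow
    past the input without affecting this comparison. *)
Definition Test : cmd 'I_20 :=
  Seq (Act (Zero vBad))
 (Seq (CheckPairs index_pairs)
      (If (obs_le vBad vZero) (Inc vFound) (Skip _))).

Definition Nest (l : seq 'I_20) := foldr (fun v => ForLt v vN1) Test l.

Definition FindPattern : cmd 'I_20 := Nest vs.

Lemma writes_CheckPair ij : {subset writes (CheckPair ij) <= [:: vBad; vH; vG; vP]}.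
Proof. by apply/allP. Qed.

Lemma writes_CheckPairs l : {subset writes (CheckPairs l) <= [:: vBad; vH; vG; vP]}.
Proof.
elim: l => [|ij l IH] i //.
rewrite -[writes _]/(writes (CheckPair ij) ++ writes (CheckPairs l)) mem_cat.
by case/orP => [/writes_CheckPair | /IH].
Qed.

Lemma writes_Test : {subset writes Test <= [:: vFound; vBad; vH; vG; vP]}.
Proof.
move=> i; rewrite -[writes Test]/([:: vBad] ++ writes (CheckPairs index_pairs) ++ [:: vFound]).
rewrite !mem_cat !inE => /or3P[/eqP-> //|/writes_CheckPairs|/eqP-> //].
by rewrite !inE => /or4P[] ->; rewrite ?orbT.
Qed.

Lemma writes_Nest l i : (i \in writes (Nest l)) = (i \in l) || (i \in writes Test).
Proof.
elim: l => //= v l IH.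
by rewrite cats0 !inE IH orbA.
Qed.

Lemma pv_in i : i < gn pat -> pv i \in vs.
Proof. by rewrite -vs_size => Hi; exact: mem_nth. Qed.

(** All auxiliary registers of the search have numbers below 10, which separates them from the
    variables ranging over the tuple. *)
Lemma vs_notin (s : seq 'I_20) i : i \in vs -> all (fun j : 'I_20 => j < 10) s -> i \notin s.
Proof.
move=> /(allP vs_ge) Hi /allP Hs; apply/negP => /Hs; lia.
Qed.

Section Run.
Variables (x : seq bool) (n b : nat).
Hypothesis n_le : n <= size x.

Definition matches (e : env 'I_20) (ij : nat * nat) :=
  (nth false x (b + e (pv ij.1) * n + e (pv ij.2)) == gedge pat ij.1 ij.2) &&
  ((e (pv ij.1) == e (pv ij.2)) == (ij.1 == ij.2)).

Definition ready (s : pstate 'I_20) := [/\ s.1 vN1 = n, s.1 vB1 = b & s.1 vZero = 0].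
Definition bounded (s : pstate 'I_20) := forall i, i \in vs -> s.1 i < n.

Lemma run_CheckPair ij s : ij \in index_pairs -> ready s -> bounded s ->
  ((run x (CheckPair ij) s).1 vBad == 0) = (s.1 vBad == 0) && matches s.1 ij.
Proof.
case: ij => i j; rewrite mem_index_pairs => /andP[Hi Hj] [EN EB _] Hb.
rewrite /CheckPair run_Seq run_If -[(i, j).1]/i -[(i, j).2]/j.
set s1 := run x (Locate _ _ _ _ _ _ _) s.
have lt k : k < gn pat -> s.1 (pv k) < n by move=> Hk; exact/Hb/pv_in.
have le k : k < gn pat -> s.1 (pv k) <= size x.
  by move=> Hk; exact: leq_trans (ltnW (lt k Hk)) n_le.
have D k : k < gn pat -> uniq [:: vP; vH; vG; pv k].
  move=> Hk; have := vs_notin (pv_in Hk) (s := [:: vP; vH; vG]) isT.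
  by rewrite -[[:: _; _; _; _]]/(rcons [:: vP; vH; vG] (pv k)) rcons_uniq => ->.
have EP : s1.1 vP = b + s.1 (pv i) * n + s.1 (pv j).
  by rewrite /s1 run_Locate ?EN ?EB ?leqW ?le ?D.
have fr k : k < gn pat -> s1.1 (pv k) = s.1 (pv k).
  by move=> Hk; rewrite /s1 run_frame //; apply: vs_notin (pv_in Hk) _.
have EX : s1.1 vBad = s.1 vBad by rewrite /s1 run_frame.
clearbody s1; rewrite /match_test /matches obs_bitE var_eqE EP !fr // le // andTb.
by case: ifP => _; rewrite ?andbT ?andbF ?EX //= updE eqxx addn1.
Qed.

Lemma ready_frame (s s' : pstate 'I_20) : ready s ->
  (forall i : 'I_20, i \in [:: vN1; vB1; vZero] -> s'.1 i = s.1 i) -> ready s'.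
Proof. by move=> [E1 E2 E3] fr; split; rewrite fr. Qed.

Lemma matches_ext (e e' : env 'I_20) ij : ij \in index_pairs -> {in vs, e =1 e'} -> matches e ij = matches e' ij.
Proof.
case: ij => i j; rewrite mem_index_pairs => /andP[Hi Hj] E.
by rewrite /matches /= !E ?pv_in.
Qed.

Lemma run_CheckPairs l s : {subset l <= index_pairs} -> ready s -> bounded s ->
  ((run x (CheckPairs l) s).1 vBad == 0) = (s.1 vBad == 0) && all (matches s.1) l.
Proof.
elim: l s => [|ij l IH] s Hl Hs Hb; first by rewrite /= andbT.
have Hij : ij \in index_pairs by apply: Hl; rewrite inE eqxx.
have Hl' : {subset l <= index_pairs} by move=> k Hk; apply: Hl; rewrite inE Hk orbT.
have fr i : i \notin [:: vBad; vH; vG; vP] -> (run x (CheckPair ij) s).1 i = s.1 i.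
  by move=> Hi; rewrite run_frame //; apply: contra Hi => /writes_CheckPair.
have frvs i : i \in vs -> (run x (CheckPair ij) s).1 i = s.1 i.
  by move=> Hi; apply: fr; exact: vs_notin Hi _.
rewrite [CheckPairs _]/= run_Seq IH // ?run_CheckPair //.
- rewrite -andbA [RHS]/=; congr (_ && (_ && _)).
  by apply: eq_in_all => k Hk; apply: matches_ext; [exact: Hl' | exact: frvs].
- apply: ready_frame Hs _ => i; rewrite !inE => /or3P[] /eqP->; exact: fr.
- by move=> i Hi; rewrite frvs ?Hb.
Qed.

Definition all_match (e : env 'I_20) := all (matches e) index_pairs.

Lemma run_Test s : ready s -> bounded s ->
  (0 < (run x Test s).1 vFound) = (0 < s.1 vFound) || all_match s.1.
Proof.
move=> Hs Hb; rewrite /Test !run_Seq run_If.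
set s1 := run x (Act _) s; set s2 := run x (CheckPairs _) s1.
have fr1 i : i != vBad -> s1.1 i = s.1 i by move=> Hi; rewrite /s1 run_frame // inE.
have fr1vs i : i \in vs -> s1.1 i = s.1 i.
  by move=> Hi; apply: fr1; have := vs_notin Hi (s := [:: vBad]) isT; rewrite inE.
have Hs1 : ready s1 by apply: ready_frame Hs _ => i; rewrite !inE => /or3P[] /eqP->; exact: fr1.
have Hb1 : bounded s1 by move=> i Hi; rewrite fr1vs ?Hb.
have E2 : (s2.1 vBad == 0) = all_match s.1.
  rewrite /s2 run_CheckPairs //= updE eqxx /=; apply: eq_in_all => k Hk.
  by apply: matches_ext => // i Hi; rewrite -fr1vs.
have fr2 i : i \notin [:: vBad; vH; vG; vP] -> s2.1 i = s1.1 i.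
  by move=> Hi; rewrite /s2 run_frame //; apply: contra Hi => /writes_CheckPairs.
have EF : s2.1 vFound = s.1 vFound by rewrite fr2 // fr1.
have EZ : s2.1 vZero = 0 by rewrite fr2 //; case: Hs1.
clearbody s2; rewrite obs_leE EZ leqn0 E2.
case: (boolP (all_match _)) E2 => [_ /eqP->|_ _] /=; last by rewrite andbF orbF EF.
by rewrite updE eqxx addn1 orbT.
Qed.

(** Each loop acts as an existential quantifier over one variable; the variables of [vs] outside [l]
    have been fixed by the outer loops. *)
Lemma run_Nest l s : uniq l -> {subset l <= vs} -> ready s ->
  (forall i, i \in vs -> i \notin l -> s.1 i < n) ->
  0 < (run x (Nest l) s).1 vFound <->
  0 < s.1 vFound \/ exists e : env 'I_20, [/\ forall i, i \in vs -> i \notin l -> e i = s.1 i,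
    forall i, i \in l -> e i < n & all_match e].
Proof.
elim: l s => [|v l IH] s Hu Hsub Hs Hb.
  rewrite run_Test //; last by move=> i Hi; exact: Hb.
  split=> [/orP[->|Hm]|[->//|[e [E _ Hm]]]]; [by left|right|apply/orP; right].
    by exists s.1; split.
  rewrite /all_match (@eq_in_all _ _ (matches e)) // => k Hk.
  by apply: matches_ext => // i Hi; rewrite E.
have Hv : v \in vs by apply: Hsub; rewrite inE eqxx.
have Hsub' : {subset l <= vs} by move=> i Hi; apply: Hsub; rewrite inE Hi orbT.
move: Hu; rewrite /= => /andP[vl Hu].
(* After [t] rounds, the flag is raised if it was so before or some matching assignment gives [v] a
   value below [t]. *)
pose found t (s' : pstate 'I_20) := 0 < s'.1 vFound <-> 0 < s.1 vFound \/
  exists e : env 'I_20, [/\ forall i, i \in vs -> i \notin v :: l -> e i = s.1 i,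
    e v < t, forall i, i \in l -> e i < n & all_match e].
have lowNest (i : 'I_20) : i < 10 -> i \notin [:: vFound; vBad; vH; vG; vP] -> i \notin v :: writes (Nest l).
  move=> Hi Hni; rewrite in_cons writes_Nest 2!negb_or; apply/and3P; split.
  - by apply: contraTneq Hv => <-; apply/negP => /(allP vs_ge); lia.
  - by apply/negP => /Hsub' /(allP vs_ge); lia.
  - by apply: contra Hni => /writes_Test.
have [EN _ _] := Hs.
have : found (s.1 vN1) (run x (Nest (v :: l)) s).
  apply: (@run_ForLt _ x v vN1 (Nest l) s found).
  - exact: lowNest.
  - by rewrite EN leqW.
  - move=> t w s' Hf; rewrite /found /= updE.
    by have /negPf-> : vFound != v by apply: contraTneq Hv => <-; apply/negP => /(allP vs_ge).
  - by split=> [|[//|[e []]] //]; left.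
  move=> t s' Ht Ev fr Hf; rewrite EN in Ht.
  have frvs i : i \in vs -> i \notin v :: l -> s'.1 i = s.1 i.
    move=> Hi; rewrite in_cons negb_or => /andP[niv Hil]; apply: fr.
    rewrite in_cons writes_Nest 2!negb_or niv Hil !andTb.
    by apply/negP => /writes_Test; apply/negP; exact: vs_notin Hi _.
  have Hs' : ready s'.
    by apply: ready_frame Hs _ => i; rewrite !inE => /or3P[] /eqP->; apply: fr; exact: lowNest.
  have Hb' i : i \in vs -> i \notin l -> s'.1 i < n.
    move=> Hi Hil; case: (eqVneq i v) => [->|niv]; first by rewrite Ev.
    have Hivl : i \notin v :: l by rewrite inE negb_or niv.
    by rewrite frvs ?Hb.
  rewrite /found; split.
  - move/(IH s' Hu Hsub' Hs' Hb') => [/Hf [|[e [E1 E2 E3 E4]]]|[e [E1 E2 E3]]]; first by left.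
      by right; exists e; split=> //; exact: ltnW.
    right; exists e; split=> //; last by rewrite E1 ?Ev.
    by move=> i Hi; rewrite inE negb_or => /andP[niv Hil]; rewrite E1 ?frvs // inE negb_or niv.
  - move=> H; apply/(IH s' Hu Hsub' Hs' Hb').
    case: H => [H0|[e [E1 E2 E3 E4]]]; first by left; apply/Hf; left.
    (* The value [t] is tried in the present round; smaller values are covered by the invariant. *)
    move: E2; rewrite ltnS leq_eqVlt => /orP[/eqP Et|Et]; last first.
      by left; apply/Hf; right; exists e.
    right; exists e; split=> // i Hi Hil; case: (eqVneq i v) => [->|niv]; first by rewrite Et.
    by rewrite E1 ?frvs // inE negb_or niv.
rewrite /found EN => ->; split; (case=> [H|[e E]]; first by left); right; exists e.
- by case: E => E1 E2 E3 E4; split=> // i; rewrite inE => /orP[/eqP-> //|]; exact: E3.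
- case: E => E1 E2 E3; split=> //; first by apply: E2; rewrite inE eqxx.
  by move=> i Hi; apply: E2; rewrite inE Hi orbT.
Qed.

End Run.

Lemma run_FindPattern (x : seq bool) (G : graph) (s : pstate 'I_20) :
  gn G <= size x -> ready (gn G) (gn G + 1) s ->
  (forall u v, u < gn G -> v < gn G -> nth false x (gn G + 1 + u * gn G + v) = gedge G u v) ->
  0 < (run x FindPattern s).1 vFound <-> 0 < s.1 vFound \/ induced_sub pat G.
Proof.
set n := gn G => Hn Hs Hx.
have sub : {subset vs <= vs} by [].
have Hb i : i \in vs -> i \notin vs -> s.1 i < n by move=> ->.
apply: (iff_trans (run_Nest (b := n + 1) Hn vs_uniq sub Hs Hb)).
split; (case=> [H|H]; first by left); right; [case: H => e [_ He Hm] | case: H => f [inj Hf]].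
- have Hm' i j : i < gn pat -> j < gn pat ->
      (gedge G (e (pv i)) (e (pv j)) = gedge pat i j) * ((e (pv i) == e (pv j)) = (i == j)).
    move=> Hi Hj; have /(allP Hm)/andP[/eqP/= E1 /eqP/= E2] : (i, j) \in index_pairs.
      by rewrite mem_index_pairs Hi.
    by rewrite -Hx ?He ?pv_in.
  exists (fun i : 'I_(gn pat) => Ordinal (He _ (pv_in (ltn_ord i)))); split.
    by move=> i j [] /eqP; rewrite Hm' // => /eqP /val_inj.
  by move=> i j; rewrite /= Hm'.
- pose e : env 'I_20 := [ffun v => if insub (index v vs) is Some i then nat_of_ord (f i) else 0].
  have ev (i : 'I_(gn pat)) : e (pv i) = f i.
    by rewrite ffunE /pv index_uniq ?vs_size // valK.
  exists e; split=> // [i Hi Hni|i Hi|].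
  + by rewrite Hi in Hni.
  + have Hlt : index i vs < gn pat by rewrite -vs_size index_mem.
    by rewrite -(nth_index vZero Hi) -[nth _ _ _]/(pv (Ordinal Hlt)) ev.
  + apply/allP => -[i j]; rewrite mem_index_pairs => /andP[Hi Hj].
    rewrite /matches /= -[i]/(nat_of_ord (Ordinal Hi)) -[j]/(nat_of_ord (Ordinal Hj)) !ev Hx //.
    by rewrite Hf !eqxx /= !val_eqE (inj_eq inj).
Qed.

End FindPattern.

(** * The reduction to Graph Isomorphism *)

Definition four_vars := [:: vr 10; vr 11; vr 12; vr 13].
Definition six_vars := [:: vr 10; vr 11; vr 12; vr 13; vr 14; vr 15].

Definition CopyInput : cmd 'I_20 := ForLt vH vL (OutIf (@obs_bit _ vH)).

Definition SearchBoth : cmd 'I_20 :=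
  Seq (Header vB1 vN1) (Seq (FindPattern diamond four_vars) (FindPattern twoP3 six_vars)).

(** Only the first graph is searched, and the input is not checked to be an encoding: a malformed
    string is copied or erased, and neither result is a yes-instance of [GI]. *)
Definition Filter : cmd 'I_20 :=
  Seq SearchBoth
 (Seq (SetEnd vL vH)
      (If (obs_le vFound vZero) CopyInput (Skip _))).

Lemma run_CopyInput x (s : pstate 'I_20) : s.1 vL = size x -> (run x CopyInput s).2 = s.2 ++ x.
Proof.
move=> EL; rewrite -{2}(mkseq_nth false x) /mkseq -flatten_map_seq1 -EL.
apply: run_ForLt_out => [||t s' Ht Eh _]; [by [] | by rewrite EL |].
by rewrite run_OutIf obs_bitE Eh.
Qed.

Definition filter_free (x : seq bool) := (run x Filter (env0 _, [::])).2.

Lemma filter_freeE x :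
  filter_free x =
  if (run x SearchBoth (env0 _, [::])).1 vFound == 0 then x else [::].
Proof.
rewrite /filter_free /Filter run_Seq; set s := run x SearchBoth _.
rewrite run_Seq run_If; set s' := run x (SetEnd vL vH) s.
have EO : s'.2 = [::].
  by rewrite /s' run_silent // /s run_silent.
have EZ : s.1 vZero = 0 by rewrite /s run_frame //= ffunE.
have EL : s'.1 vL = size x by rewrite /s' run_SetEnd.
have fr i : i \notin [:: vH; vL] -> s'.1 i = s.1 i by move=> Hi; rewrite /s' run_frame.
clearbody s'; clearbody s; rewrite obs_leE !fr // EZ leqn0 andbC.
case: eqP => [->|_]; last by [].
by rewrite leq0n andbT run_CopyInput // EO.
Qed.

Lemma filter_free_enc_pair G H : size (gadj G) = gn G * gn G ->
  filter_free (enc_pair G H) = enc_pair G H <-> diamond_2P3_free G.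
Proof.
move=> sG; rewrite filter_freeE; set x := enc_pair G H.
have En : find negb x = gn G by rewrite /x /enc_pair enc_graph_cat find_ones.
pose s0 : pstate 'I_20 := (env0 _, [::]); have z0 i : s0.1 i = 0 by rewrite /= ffunE.
rewrite (run_Seq _ (Header _ _)) (run_Seq _ (FindPattern diamond four_vars)) -/s0.
have [] := run_Header x (p := vB1) (c := vN1) s0 isT.
set s1 := run x (Header vB1 vN1) s0; rewrite !z0 drop0 !add0n En => B1 N1.
have Z1 : s1.1 vZero = 0 by rewrite /s1 run_frame.
have F1 : s1.1 vFound = 0 by rewrite /s1 run_frame.
clearbody s1.
have Hn : gn G <= size x by rewrite -En find_size.
have Hx u v : u < gn G -> v < gn G -> nth false x (gn G + 1 + u * gn G + v) = gedge G u v.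
  move=> Hu Hv; rewrite -gedge_decode_at // -[in RHS](decode_enc_graph [::] (enc_graph H) sG).
  by [].
have R1 : ready (gn G) (gn G + 1) s1 by split.
have F2 := run_FindPattern (pat := diamond) (vs := four_vars) isT isT erefl Hn R1 Hx.
set s2 := run x (FindPattern diamond four_vars) s1 in F2 *.
have R2 : ready (gn G) (gn G + 1) s2.
  by apply: ready_frame R1 _ => i; rewrite !inE => /or3P[] /eqP->; rewrite /s2 run_frame.
clearbody s2.
have F3 := run_FindPattern (pat := twoP3) (vs := six_vars) isT isT erefl Hn R2 Hx.
set s3 := run x (FindPattern twoP3 six_vars) s2 in F3 *.
clearbody s3; rewrite F1 in F2.
split.
- case: eqP => [E _|_ /esym/enc_pair_neq_nil //].
  have nF3 : ~ 0 < s3.1 vFound by rewrite E.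
  by split=> Hi; apply: nF3; apply/F3; [left; apply/F2; right | right].
- move=> [nd np]; case: eqP => // /eqP; rewrite -lt0n => /F3[/F2[//|]|] //.
Qed.

(** For arbitrary inputs this is enough: a result that encodes a pair of graphs is nonempty, so it
    is the input itself. *)
Lemma filter_free_cases x : filter_free x = x \/ filter_free x = [::].
Proof. by rewrite filter_freeE; case: eqP; [left | right]. Qed.

Lemma isomorphic_sym G H : isomorphic G H -> isomorphic H G.
Proof.
move=> /isomorphicP[En [f [g iso]]]; apply/isomorphicP; split=> //.
by exists g, f; exact: iso_maps_sym.
Qed.

Lemma induced_sub_iso P G H : isomorphic G H -> induced_sub P G -> induced_sub P H.
Proof.
move=> [f [bij_f Hf]] [g [inj_g Hg]]; exists (f \o g); split.
  exact: inj_comp (bij_inj bij_f) inj_g.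
by move=> i j; rewrite Hg Hf.
Qed.

Lemma free_reduces : poly_reduces (GI_on diamond_2P3_free) GI.
Proof.
exists filter_free; split; first exact: loop_poly_computable.
move=> x; split.
- move=> [G [H [[sG sH fG fH] [-> iso]]]].
  have -> : filter_free (enc_pair G H) = enc_pair G H by apply/filter_free_enc_pair => //; case: sG.
  by exists G, H.
- move=> [G [H [[sG sH _ _] [E iso]]]].
  have Ex : x = enc_pair G H.
    by case: (filter_free_cases x) E => -> // /esym/enc_pair_neq_nil.
  rewrite Ex in E.
  have [nd np] := (filter_free_enc_pair H sG.1).1 E.
  exists G, H; split; last by split.
  (* A forbidden subgraph of [H], which was not searched, would be carried back to [G] by the
     isomorphism. *)
  split=> //; split=> /(induced_sub_iso (isomorphic_sym iso)) //.
Qed.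

Theorem theorem5 : GI_complete diamond_2P3_free.
Proof. by split; [exact: GI_reduces | exact: free_reduces]. Qed.
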